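(* Let $m\ge 2$ and $n\ge 2$ be integers, let $\Omega\subset\mathbb{R}^n$ be a domain, and let $x_0\in\Omega$. Suppose $u$ is a solution of the polyharmonic equation $\Delta^m u=0$ in $\Omega\setminus\{x_0\}$ which satisfies $$ |u(x)|=\begin{cases} o(|x-x_0|^{2m-n}) \quad\text{as } |x-x_0|\to 0, & \text{if } n\ge 3,\\ o\bigl(|x-x_0|^{2m-2}\log(|x-x_0|^{-1})\bigr)\quad\text{as } |x-x_0|\to 0, & \text{if } n=2.\end{cases} $$ Then $u$ has a removable singularity at $x_0$.
   Context: $\Delta$ is the Laplacian on $\mathbb{R}^n$ and $\Delta^m$ is its $m$-fold iterate. A domain is a nonempty connected open set. A solution of $\Delta^m u=0$ in an open set is a real-valued classical solution, i.e. a $C^{2m}$ function satisfying the equation pointwise there. Write $B_\delta(x_0)=\{x\in\mathbb{R}^n:|x-x_0|<\delta\}$. A solution $u$ of $\Delta^m u=0$ in $\Omega\setminus\{x_0\}$ is said to have a removable singularity at $x_0$ if there exist a constant $\delta>0$ with $\overline{B_\delta(x_0)}\subset\Omega$ and a smooth ($C^\infty$) solution $v$ of $\Delta^m v=0$ in $B_\delta(x_0)$ such that $u(x)=v(x)$ for all $0<|x-x_0|<\delta$. *)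

(* Defs.v *)
From HB Require Import structures.
From mathcomp Require Import all_boot all_order all_algebra.
From mathcomp Require Import all_classical all_reals all_analysis.
Set Implicit Arguments.
Unset Strict Implicit.
Unset Printing Implicit Defensive.
Import Order.TTheory GRing.Theory Num.Theory.
Import numFieldNormedType.Exports.
Local Open Scope classical_set_scope.
Local Open Scope ring_scope.

(* The norm that the library puts on ['rV[R]_n] is the sup norm; it induces the
   usual topology, but the length |x| of a vector has to be defined here. *)
Definition enorm (R : realType) (n : nat) (x : 'rV[R]_n) : R :=
  Num.sqrt (\sum_(i < n) x ord0 i ^+ 2).

Definition eball (R : realType) (n : nat) (x0 : 'rV[R]_n) (r : R)
  : set 'rV[R]_n := [set x | enorm (x - x0) < r].

Definition domain (R : realType) (n : nat) (A : set 'rV[R]_n) : Prop :=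
  [/\ A !=set0, open A & connected A].

Definition partial (R : realType) (n : nat) (i : 'I_n) (f : 'rV[R]_n -> R)
  : 'rV[R]_n -> R := fun x => 'D_(delta_mx ord0 i) f x.

(* For an open set [A]: every iterated partial derivative of [f] of order at
   most [k] exists at each point of [A] and is continuous there. The operator
   ['D_v] is total, so existence is required separately; since [A] is open,
   the values of [f] outside [A] play no role. *)
Fixpoint class_C (R : realType) (n : nat) (k : nat) (A : set 'rV[R]_n)
    (f : 'rV[R]_n -> R) : Prop :=
  (forall x, A x -> {for x, continuous f}) /\
  match k with
  | 0 => True
  | k'.+1 => forall i : 'I_n,
      (forall x, A x -> derivable f x (delta_mx ord0 i)) /\
      class_C k' A (partial i f)
  end.

Definition smooth (R : realType) (n : nat) (A : set 'rV[R]_n)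
    (f : 'rV[R]_n -> R) : Prop := forall k, class_C k A f.

Definition laplacian (R : realType) (n : nat) (f : 'rV[R]_n -> R)
  : 'rV[R]_n -> R := fun x => \sum_(i < n) partial i (partial i f) x.

Definition polyharmonic (R : realType) (n m : nat) (A : set 'rV[R]_n)
    (u : 'rV[R]_n -> R) : Prop :=
  class_C (2 * m) A u /\ forall x, A x -> iter m (@laplacian R n) u x = 0.

Definition removable_singularity (R : realType) (n m : nat)
    (A : set 'rV[R]_n) (x0 : 'rV[R]_n) (u : 'rV[R]_n -> R) : Prop :=
  exists delta : R, exists v : 'rV[R]_n -> R,
    [/\ 0 < delta,
        closure (eball x0 delta) `<=` A,
        smooth (eball x0 delta) v,
        polyharmonic m (eball x0 delta) v &
        forall x, 0 < enorm (x - x0) < delta -> u x = v x].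

(* Main.v *)
(* Everything rests on the maximum principle on cubes (the balls of the sup
   norm); no integral is used.  Comparing the odd part of u across a hyperplane
   with a quadratic polynomial bounds the gradient of u by the sup norms of u and
   Delta u, and adding multiples of the radial harmonic function G with a pole at
   x0 (|x|^(2-n), or -log |x| if n = 2) keeps this bound uniform up to x0.  By
   induction on m and an absorption argument one gets interior estimates for
   polyharmonic functions, hence, applied to difference quotients, smoothness
   away from x0.  Scaled, they turn the growth hypothesis into
   Delta^j u = o(G) for all j < m.  If f = o(G) and Delta f is bounded together
   with all its derivatives, then by the maximum principle f is bounded, and by
   the gradient bound, applied successively, so are all its derivatives.  Starting
   from Delta^m u = 0 and descending to u, all derivatives of u are bounded near
   x0; so they are Lipschitz and extend continuously to x0. *)
Require Import Defs.
From HB Require Import structures.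
From mathcomp Require Import all_boot all_order all_algebra.
From mathcomp Require Import all_classical all_reals all_analysis.
From mathcomp Require Import ring lra.
Set Implicit Arguments.
Unset Strict Implicit.
Unset Printing Implicit Defensive.
Import Order.TTheory GRing.Theory Num.Theory.
Import numFieldNormedType.Exports.
Local Open Scope classical_set_scope.
Local Open Scope ring_scope.

(** * Directional derivatives *)

(** The exponent in the hypothesis is 2(m-1) plus that of the radial harmonic function, so u =
    o(|x-x0|^(2(m-1)) G). In the interior estimates each Laplacian costs a factor |x-x0|^(-2), and
    m-1 of them just use up the power; hence every function met in the descent is o(G), the
    borderline at which small multiples of G still dominate at the pole. The odd part vanishes on
    the hyperplane, and its slope there is the wanted derivative; reflecting creates a second
    singularity at the mirror image of x0, hence two poles in the comparison. For m > 1 the gradient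
    bound asks for a bound on Delta u that u does not give at once: this is the obstacle that
    absorption removes. A second one is that u is only C^(2m): its partial derivatives are not yet
    known to be polyharmonic, whereas its difference quotients are. The assumption n >= 2 enters in
    the barrier and in walking around x0 along coordinate segments. *)

Lemma nbhs_norm_ltP (R : realType) (V : normedModType R) (x : V) (P : V -> Prop) :
  (\forall y \near x, P y) <->
  exists2 e : R, 0 < e & forall y, `|y - x| < e -> P y.
Proof.
rewrite nbhs_normP; split=> -[e e0 H]; exists e => // y.
  by move=> yx; apply: H; rewrite /ball_/= distrC.
by rewrite /ball_/= distrC => yx; exact: H.
Qed.

Lemma dnbhs_norm_ltP (R : realType) (V : normedModType R) (x : V) (P : V -> Prop) :
  (\forall y \near x^', P y) <->
  exists2 e : R, 0 < e & forall y, y != x -> `|y - x| < e -> P y.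
Proof.
rewrite near_withinE; split=> [/nbhs_norm_ltP[e e0 H]|[e e0 H]].
  by exists e => // y yx ye; apply: H.
by apply/nbhs_norm_ltP; exists e => // y ye yx; apply: H.
Qed.

Lemma open_norm_sub (R : realType) (V : normedModType R) (A : set V) (x : V) :
  open A -> A x -> exists2 e : R, 0 < e & forall y, `|y - x| < e -> A y.
Proof. by move=> oA Ax; apply/nbhs_norm_ltP; exact: open_nbhs_nbhs. Qed.

Lemma open_setD1 (R : realType) (V : normedModType R) (A : set V) (z : V) :
  open A -> open (A `\ z).
Proof.
move=> oA; apply: openI => //; rewrite openC.
by apply: accessible_closed_set1; apply: hausdorff_accessible; exact: norm_hausdorff.
Qed.

Lemma contE (R : realType) (V : normedModType R) (f : V -> R) (x : V) :
  {for x, continuous f} <-> forall e : R, 0 < e ->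
   exists2 d, 0 < d & forall y, `|y - x| < d -> `|f y - f x| < e.
Proof.
split.
  move=> /cvgrPdist_lt cf e e0; have /nbhs_norm_ltP [d d0 H] := cf e e0.
  by exists d => // y yd; rewrite distrC; exact: H.
move=> H; apply/cvgrPdist_lt => e e0; apply/nbhs_norm_ltP.
have [d d0 Hd] := H e e0; exists d => // y yd.
by rewrite distrC; exact: Hd.
Qed.

(** Lets e tend to 0 with all other data fixed. No sign is imposed on [c], which will often be a
    combination of barrier values. *)
Lemma le_eps_mul (R : realType) (a b c : R) :
  (forall e, 0 < e -> a <= b + e * c) -> a <= b.
Proof.
move=> H; apply/ler_addgt0Pr => e e0.
have c0 : 0 < 1 + `|c| by rewrite ltr_pwDl.
apply: le_trans (H (e / (1 + `|c|)) _) _; first by rewrite divr_gt0.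
rewrite lerD2l -mulrA ler_piMr ?(ltW e0)// ler_pdivrMl// mulr1.
by rewrite (le_trans (ler_norm c))// lerDr.
Qed.

(* [is_derive] is a type class; hiding it behind a plain definition keeps
   instance resolution from choosing the value of the derivative. *)
Definition dv (R : realType) (V : normedModType R) (x v : V) (f : V -> R) (a : R)
  : Prop := is_derive x v f a.

Section pointwise.
Context {R : realType} {V : normedModType R}.
Implicit Types (f g : V -> R) (x v : V) (a b c : R).

Lemma dv_cst x v c : dv x v (fun _ : V => c) (0 : R).
Proof. exact: (is_derive_cst c x v). Qed.

Lemma dvD f g x v a b : dv x v f a -> dv x v g b ->
  dv x v (fun y => f y + g y) (a + b).
Proof. by move=> ? ?; exact: is_deriveD. Qed.

Lemma dvN f x v a : dv x v f a -> dv x v (fun y => - f y) (- a).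
Proof. by move=> ?; exact: is_deriveN. Qed.

Lemma dvB f g x v a b : dv x v f a -> dv x v g b ->
  dv x v (fun y => f y - g y) (a - b).
Proof. by move=> ? ?; exact: is_deriveB. Qed.

Lemma dvZ f x v a c : dv x v f a -> dv x v (fun y => c * f y) (c * a).
Proof. by move=> ?; exact: is_deriveZ. Qed.

Lemma dvM f g x v a b : dv x v f a -> dv x v g b ->
  dv x v (fun y => f y * g y) (f x * b + g x * a).
Proof. by move=> ? ?; exact: is_deriveM. Qed.

Lemma dv_sum m (h : 'I_m -> V -> R) x v (dh : 'I_m -> R) :
  (forall i, dv x v (h i) (dh i)) ->
  dv x v (fun y => \sum_(i < m) h i y) (\sum_(i < m) dh i).
Proof.
move=> H; rewrite (_ : (fun _ => _) = \sum_(i < m) h i); first exact: is_derive_sum.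
by apply/funext => y; rewrite fct_sumE.
Qed.

Lemma dv_eq f x v a b : dv x v f a -> a = b -> dv x v f b.
Proof. by move=> ? <-. Qed.

End pointwise.

Lemma dv_id (R : realType) (x : R) : dv x 1 (fun t : R => t) 1.
Proof. exact: is_derive_id. Qed.

Section lines.
Context {R : realType} {V : normedModType R}.
Implicit Types (f g : V -> R) (x y v : V).

(** This and [dv_lineat] pass to one variable, where the chain rule, the mean value theorem and the
    criterion for extrema are available. *)
Lemma dv_line f x v l :
  dv x v f l <-> dv (0 : R) 1 (fun t => f (t *: v + x)) l.
Proof.
rewrite /dv.
have E : (fun h => h^-1 *: ((f \o shift x) (h *: v) - f x)) =
   (fun h : R => h^-1 *: (((fun t => f (t *: v + x)) \o shift (0:R)) (h *: (1:R))
     - f ((0:R) *: v + x))).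
  by rewrite funeqE => h /=; rewrite addr0 scale0r add0r [_%:A]mulr1.
by split=> -[+ +]; rewrite /derivable /derive => D1 D2; split;
  rewrite /derivable /derive ?E // -?E.
Qed.

Lemma dv_lineat f x v (t : R) l :
  dv (t *: v + x) v f l <->
  dv t 1 (fun s => f (s *: v + x)) l.
Proof.
rewrite /dv.
have E : (fun h => h^-1 *: ((f \o shift (t *: v + x)) (h *: v) - f (t *: v + x))) =
   (fun h : R => h^-1 *: (((fun t => f (t *: v + x)) \o shift t) (h *: (1:R))
     - f (t *: v + x))).
  by rewrite funeqE => h /=; rewrite [_%:A]mulr1 scalerDl addrA.
by split=> -[+ +]; rewrite /derivable /derive => D1 D2; split;
  rewrite /derivable /derive ?E // -?E.
Qed.

Lemma dv_comp (h : V -> R) (G : R -> R) x v (l g : R) :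
  dv x v h l -> dv (h x) 1 G g ->
  dv x v (fun y => G (h y)) (g * l).
Proof.
move=> /dv_line Dh DG; apply/dv_line.
have E : h x = h ((0 : R) *: v + x) by rewrite scale0r add0r.
rewrite E in DG.
exact: (@is_derive1_comp _ G (fun t => h (t *: v + x)) 0 g l DG Dh).
Qed.

(** The intermediate point is parametrised by [s] in [0, 1], so that [a] may have either sign. *)
Lemma MVT_dir f x v (a : R) :
  (forall s : R, 0 <= s <= 1 -> derivable f ((s * a) *: v + x) v) ->
  exists2 s : R, 0 <= s <= 1 &
    f (a *: v + x) - f x = a * 'D_v f ((s * a) *: v + x).
Proof.
move=> df.
pose g (s : R) := f ((s * a) *: v + x).
have Dg (s : R) : 0 <= s <= 1 -> dv s 1 g (a * 'D_v f ((s * a) *: v + x)).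
  move=> s01; have /derivableP/dv_lineat D := df s s01.
  rewrite mulrC.
  apply: (@is_derive1_comp _ (fun t => f (t *: v + x)) (fun s => s * a) s _ a D).
  suff : dv s 1 (fun s : R => s * a) a by [].
  apply: dv_eq.
    by apply: dvM; [exact: dv_id|exact: dv_cst].
  by rewrite mulr0 add0r mulr1.
have [||s + E] := @MVT_segment _ g (fun s => a * 'D_v f ((s * a) *: v + x)) 0 1 ler01.
- by move=> s; rewrite in_itv /= => /andP[s0 s1]; apply: Dg; rewrite !ltW.
- apply: derivable_within_continuous => s; rewrite in_itv/= => /Dg [] //.
rewrite in_itv /= => s01; exists s => //.
by move: E; rewrite /g mul1r mul0r scale0r add0r subr0 mulr1.
Qed.

End lines.

Section coordinates.
Context {R : realType} {n : nat}.
Local Notation V := 'rV[R]_n.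
Local Notation ei i := (delta_mx (ord0 : 'I_1) i : V).
Implicit Types (f g : V -> R) (x y v : V).

Lemma line_entry (t : R) (i : 'I_n) x j :
  (t *: ei i + x) ord0 j = x ord0 j + t * (i == j)%:R.
Proof. by rewrite !mxE eqxx /= addrC eq_sym. Qed.

Lemma rv_norm_le x (d : R) : 0 <= d ->
  (`|x| <= d) <-> (forall i, `|x ord0 i| <= d).
Proof.
move=> d0; split.
  move=> xd i; apply: le_trans xd; rewrite [leRHS]mx_normrE.
  exact: (le_bigmax _ (fun i : 'I_1 * 'I_n => `|x i.1 i.2|) (ord0, i)).
move=> H; rewrite [leLHS]mx_normrE; apply: bigmax_le => // -[i j] _ /=.
by rewrite (ord1 i).
Qed.

Lemma entry_le x i : `|x ord0 i| <= `|x|.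
Proof. by have /(_ i) := (rv_norm_le x (normr_ge0 x)).1 (lexx _). Qed.

Lemma norm_ei (i : 'I_n) : `|ei i| = 1.
Proof.
apply/eqP; rewrite eq_le; apply/andP; split.
  apply/rv_norm_le => // j; rewrite mxE eqxx /=.
  by case: (j == i); rewrite ?normr1 ?normr0.
by have := entry_le (ei i) i; rewrite mxE !eqxx /= normr1.
Qed.

Lemma norm_scale_ei (t : R) (i : 'I_n) : `|t *: ei i| = `|t|.
Proof. by rewrite normrZ norm_ei mulr1. Qed.

Lemma dv_entry x (i j : 'I_n) :
  dv x (ei j) (fun y => y ord0 i) (i == j)%:R.
Proof.
apply/dv_line.
rewrite (_ : (fun _ => _) = (fun t : R => x ord0 i + t * (j == i)%:R)); last first.
  by apply/funext => t; rewrite line_entry.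
apply: dv_eq.
  apply: dvD; first exact: dv_cst.
  by apply: dvM; [exact: dv_id|exact: dv_cst].
by rewrite mulr0 add0r add0r mulr1 eq_sym.
Qed.

End coordinates.

(** * The maximum principle *)

Section second_derivative.
Context {R : realType}.

Lemma dvP (V : normedModType R) (x v : V) (f : V -> R) (l : R) :
  dv x v f l <-> forall e : R, 0 < e -> exists2 d : R, 0 < d &
    forall t, t != 0 -> `|t| < d -> `|t^-1 * (f (t *: v + x) - f x) - l| < e.
Proof.
pose q := fun h : R => h^-1 *: ((f \o shift x) (h *: v) - f x).
have E : dv x v f l <-> q @ 0^' --> l.
  split; last first.
    move=> ql; split; first by apply/cvg_ex; exists l.
    exact: (cvg_lim _ ql).
  by move=> [D <-]; exact: D.
rewrite E; split.
  move=> /cvgrPdist_lt C e e0; have /dnbhs_norm_ltP [d d0 H] := C e e0.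
  exists d => // t t0 td; rewrite distrC; apply: H => //.
  by rewrite subr0.
move=> H; apply/cvgrPdist_lt => e e0; apply/dnbhs_norm_ltP.
have [d d0 Hd] := H e e0; exists d => // t t0; rewrite subr0 => td.
by rewrite distrC; exact: Hd.
Qed.

(** A relation at a single point: explicit derivatives of polynomials and barriers can be supplied
    as witnesses, and nothing is asked at the poles. *)
Definition sec (V : normedModType R) (x v : V) (f : V -> R) (l : R) : Prop :=
  exists2 g : V -> R, (\forall y \near x, dv y v f (g y)) & dv x v g l.

Lemma sec_eq (V : normedModType R) (x v : V) f a b :
  sec x v f a -> a = b -> sec x v f b.
Proof. by move=> ? <-. Qed.

Lemma sec_cst (V : normedModType R) (x v : V) (c : R) : sec x v (fun=> c) 0.
Proof.
exists (fun=> 0); last exact: dv_cst.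
by apply: filterE => y; exact: dv_cst.
Qed.

Lemma secD (V : normedModType R) (x v : V) f g a b :
  sec x v f a -> sec x v g b -> sec x v (fun y => f y + g y) (a + b).
Proof.
move=> [f1 Hf Df] [g1 Hg Dg]; exists (fun y => f1 y + g1 y); last exact: dvD.
by apply: filterS2 Hf Hg => y; exact: dvD.
Qed.

Lemma secZ (V : normedModType R) (x v : V) f a c :
  sec x v f a -> sec x v (fun y => c * f y) (c * a).
Proof.
move=> [f1 Hf Df]; exists (fun y => c * f1 y); last exact: dvZ.
by apply: filterS Hf => y; exact: dvZ.
Qed.

Lemma secN (V : normedModType R) (x v : V) f a :
  sec x v f a -> sec x v (fun y => - f y) (- a).
Proof.
move=> [f1 Hf Df]; exists (fun y => - f1 y); last exact: dvN.
by apply: filterS Hf => y; exact: dvN.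
Qed.

Lemma secB (V : normedModType R) (x v : V) f g a b :
  sec x v f a -> sec x v g b -> sec x v (fun y => f y - g y) (a - b).
Proof. by move=> Hf Hg; apply: secD => //; exact: secN. Qed.

Lemma dv_affine (V : normedModType R) (sg : V -> V) (x v w : V) f a :
  (forall t : R, sg (t *: v + x) = t *: w + sg x) ->
  dv (sg x) w f a -> dv x v (fun y => f (sg y)) a.
Proof.
move=> H /dvP D; apply/dvP => e e0; have [d d0 Hd] := D e e0.
by exists d => // t t0 td; rewrite H; exact: Hd.
Qed.

Lemma dv_opp_dir (V : normedModType R) (x v : V) f a :
  dv x v f a -> dv x (- v) f (- a).
Proof.
move=> /dvP D; apply/dvP => e e0; have [d d0 Hd] := D e e0.
exists d => // t t0 td; rewrite scalerN -scaleNr.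
have := Hd (- t); rewrite oppr_eq0 normrN => /(_ t0 td).
by rewrite invrN mulNr -opprD normrN opprK.
Qed.

Lemma sec_opp_dir (V : normedModType R) (x v : V) f a :
  sec x v f a -> sec x (- v) f a.
Proof.
move=> [g Hg Dg]; exists (fun y => - g y).
  by apply: filterS Hg => y; exact: dv_opp_dir.
by rewrite -[a]opprK; apply: dvN; exact: dv_opp_dir.
Qed.

Lemma sec_affine (V : normedModType R) (sg : V -> V) (x v w : V) f a :
  continuous sg ->
  (forall y (t : R), sg (t *: v + y) = t *: w + sg y) ->
  sec (sg x) w f a -> sec x v (fun y => f (sg y)) a.
Proof.
move=> csg H [g Hg Dg]; exists (fun y => g (sg y)).
  have Hn : \forall y \near x, dv (sg y) w f (g (sg y)) by exact: csg x _ Hg.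
  by apply: filterS Hn => y; apply: dv_affine.
exact: dv_affine Dg.
Qed.

(** The first derivative [g] vanishes at the maximum. If [l] were positive, [g] would be positive
    just after it on the line, and the mean value theorem would make [f] exceed its maximum. *)
Lemma sec_max (V : normedModType R) (x v : V) (f : V -> R) (l : R) :
  sec x v f l -> (\forall y \near x, f y <= f x) -> l <= 0.
Proof.
move=> [g Hg /dvP Dg] Hmax; rewrite leNgt; apply/negP => l0.
have [d d0 Hd] := (nbhs_norm_ltP x _).1 (filterI Hg Hmax).
(* The 1 covers v = 0: |t| < d / C keeps t v within d in every case. *)
pose C := 1 + `|v|; have C0 : 0 < C by rewrite ltr_pwDl.
have Hd' (t : R) : `|t| < d / C -> dv (t *: v + x) v f (g (t *: v + x)) /\
    f (t *: v + x) <= f x.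
  move=> td; apply: Hd; rewrite addrK normrZ.
  rewrite -(ltr_pM2r C0) divfK ?gt_eqF// in td.
  by apply: le_lt_trans td; rewrite ler_wpM2l// lerDr.
have gx0 : g x = 0.
  have dC0 : 0 < d / C by rewrite divr_gt0.
  have D0 : is_derive (0 : R) 1 (fun t => f (t *: v + x)) 0.
    apply: (@derive1_at_max _ _ (- (d / C)) (d / C)).
    - by rewrite ge0_cp// ltW.
    - move=> t; rewrite in_itv /= => /andP[t1 t2].
      have [|D _] := Hd' t; first by rewrite ltr_norml t1.
      by have [] := (dv_lineat _ _ _ _ _).1 D.
    - by rewrite in_itv /= dC0 oppr_lt0 dC0.
    - move=> t; rewrite in_itv /= => /andP[t1 t2].
      rewrite scale0r add0r; apply: (Hd' t _).2.
      by rewrite ltr_norml t1.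
  have [|D1 _] := Hd' 0; first by rewrite normr0.
  move: ((dv_lineat _ _ _ _ _).1 D1); rewrite scale0r add0r => -[_ <-].
  by case: D0.
have [d2 d20 H2] := Dg l l0.
pose t := Num.min (d / C) d2 / 2.
have m0 : 0 < Num.min (d / C) d2 by rewrite lt_min divr_gt0.
have t0 : 0 < t by rewrite divr_gt0.
have tm : t < Num.min (d / C) d2 by rewrite ltr_pdivrMr// ltr_pMr// ltr1n.
have {tm} /andP[t1 t2] : (t < d / C) && (t < d2) by rewrite -lt_min.
have [s|s |s] := @MVT _ (fun t => f (t *: v + x))
    (fun t => g (t *: v + x)) 0 t t0.
- rewrite in_itv /= => /andP[s0 s1]; have [|D _] := Hd' s.
    by rewrite gtr0_norm// (lt_trans s1).
  exact: (dv_lineat _ _ _ _ _).1 D.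
- apply: derivable_within_continuous => {}s; rewrite in_itv/= => /andP[s0 s1].
  have [|D _] := Hd' s; first by rewrite ger0_norm// (le_lt_trans s1).
  by have [] := (dv_lineat _ _ _ _ _).1 D.
rewrite in_itv /= => /andP[s0 s1]; rewrite scale0r add0r subr0 => E.
have [|_] := Hd' t; first by rewrite gtr0_norm.
have := H2 s; rewrite gt_eqF// gtr0_norm// (lt_trans s1)// gx0 subr0 => /(_ isT isT).
rewrite ltr_norml ltrBrDr addNr => /andP[+ _].
rewrite pmulr_rgt0 ?invr_gt0// => g0.
by rewrite -subr_le0 E leNgt mulr_gt0.
Qed.

End second_derivative.

Section max_principle.
Context {R : realType} {n : nat}.
Local Notation V := 'rV[R]_n.
Local Notation ei i := (delta_mx (ord0 : 'I_1) i : V).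

Lemma cont_within (A : set V) (f : V -> R) :
  (forall x, A x -> {for x, continuous f}) -> {within A, continuous f}.
Proof. by move=> H; apply: continuous_in_subspaceT => x; rewrite inE => /H. Qed.

(** A positive maximum over the part of K outside N is a local maximum of w, since nearby points of
    N have w <= 0; so all second derivatives there are <= 0, against their positive sum. [N] is a
    neighbourhood of the poles. As the hypotheses are asked only where w > 0, boundary points of K
    are dealt with by showing w <= 0 there. *)
Lemma max_principle (K N : set V) (w : V -> R) :
  compact K -> open N ->
  (forall x, K x -> ~ N x -> {for x, continuous w}) ->
  (forall x, K x -> ~ N x -> 0 < w x ->
     (\forall y \near x, K y /\ (N y -> w y <= 0)) /\
     exists2 l : 'I_n -> R, (forall i, sec x (ei i) w (l i)) & 0 < \sum_i l i) ->
  forall x, K x -> ~ N x -> w x <= 0.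
Proof.
move=> cK oN cw H x Kx Nx.
have cKN : compact (K `&` ~` N).
  by apply: compact_closedI => //; exact: open_closedC.
have KN0 : (K `&` ~` N) !=set0 by exists x.
have cwKN : {within K `&` ~` N, continuous w}.
  by apply: cont_within => y [Ky Ny]; exact: cw.
have [c] := EVT_max_rV KN0 cKN cwKN; rewrite inE => -[Kc Nc] maxc.
have xc : w x <= w c by apply: maxc; rewrite inE.
apply: le_trans xc _; rewrite leNgt; apply/negP => wc.
have [near_c [l Hl l0]] := H c Kc Nc wc.
apply/negP: l0; rewrite -leNgt; apply: sumr_le0 => i _.
apply: sec_max (Hl i) _; apply: filterS near_c => y [Ky Ny].
have [NNy|NNy] := pselect (N y); first by rewrite (le_trans (Ny NNy))// ltW.
by apply: maxc; rewrite inE.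
Qed.

End max_principle.

(** * Functions of class C^k *)

Section class_C_theory.
Context {R : realType} {n : nat}.
Local Notation V := 'rV[R]_n.
Local Notation ei i := (delta_mx (ord0 : 'I_1) i : V).
Implicit Types (f g : V -> R) (x y : V) (A : set V) (k : nat).

Lemma class_C_cont k A f x : class_C k A f -> A x -> {for x, continuous f}.
Proof. by case: k => [|k] [] H _; exact: H. Qed.

Lemma class_C_derivable k A f i x :
  class_C k.+1 A f -> A x -> derivable f x (ei i).
Proof. by move=> [_ /(_ i)[]] H _; exact: H. Qed.

Lemma class_C_dv k A f i x :
  class_C k.+1 A f -> A x -> dv x (ei i) f (partial i f x).
Proof. by move=> Cf Ax; apply: derivableP; exact: class_C_derivable Cf Ax. Qed.

Lemma class_C_partial k A f i : class_C k.+1 A f -> class_C k A (partial i f).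
Proof. by move=> [_ /(_ i)[]]. Qed.

Lemma class_CW k A f : class_C k.+1 A f -> class_C k A f.
Proof.
elim: k f => [|k IH] f [cf H]; first by split.
split=> // i; have [df Cf] := H i; split=> //; exact: IH.
Qed.

Lemma class_C_le k l A f : (k <= l)%N -> class_C l A f -> class_C k A f.
Proof.
move=> /subnK <-; elim: (l - k)%N => // m IH; rewrite addSn => /class_CW.
exact: IH.
Qed.

Lemma class_C_sub k A B f : A `<=` B -> class_C k B f -> class_C k A f.
Proof.
move=> AB; elim: k f => [|k IH] f [cf H].
  by split=> // x /AB; exact: cf.
split=> [x /AB|i]; first exact: cf.
have [df Cf] := H i; split=> [x /AB|]; [exact: df|exact: IH].
Qed.

Lemma partial_eq A f g i x : open A -> (forall y, A y -> f y = g y) -> A x ->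
  partial i f x = partial i g x.
Proof.
move=> oA fg Ax; apply: near_eq_derive.
have := open_nbhs_nbhs (conj oA Ax); apply: filterS => y; exact: fg.
Qed.

(** The computed formula for a partial derivative agrees with the total function [partial i f] only
    on [A]; this transfer makes the closure properties below go through. *)
Lemma class_C_eq k A f g : open A -> (forall y, A y -> f y = g y) ->
  class_C k A f -> class_C k A g.
Proof.
move=> oA; elim: k f g => [|k IH] f g fg [cf H].
  split=> // x Ax; have cfx := cf x Ax.
  apply/contE => e e0; have [d d0 Hd] := (contE _ _).1 cfx e e0.
  have [d2 d20 Hd2] := open_norm_sub oA Ax.
  exists (Num.min d d2); first by rewrite lt_min d0.
  by move=> y; rewrite lt_min => /andP[yd yd2]; rewrite -!fg//; [exact: Hd|exact: Hd2].
have nfg x : A x -> \forall y \near x, f y = g y.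
  by move=> Ax; have := open_nbhs_nbhs (conj oA Ax); apply: filterS => y; exact: fg.
split=> [x Ax|i].
  apply/contE => e e0; have [d d0 Hd] := (contE _ _).1 (cf x Ax) e e0.
  have [d2 d20 Hd2] := open_norm_sub oA Ax.
  exists (Num.min d d2); first by rewrite lt_min d0.
  by move=> y; rewrite lt_min => /andP[yd yd2]; rewrite -!fg//; [exact: Hd|exact: Hd2].
have [df Cf] := H i; split=> [x Ax|].
  exact: near_eq_derivable (nfg x Ax) (df x Ax).
by apply: IH Cf => y Ay; exact: (partial_eq _ oA fg Ay).
Qed.

Lemma dv_val x v f l : dv x v f l -> 'D_v f x = l.
Proof. by case. Qed.

Lemma class_CD k A f g : open A -> class_C k A f -> class_C k A g ->
  class_C k A (fun y => f y + g y).
Proof.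
move=> oA; elim: k f g => [|k IH] f g Cf Cg.
  by split=> // x Ax; apply: continuousD; [exact: class_C_cont Cf Ax|exact: class_C_cont Cg Ax].
have D i x : A x -> dv x (ei i) (fun y => f y + g y) (partial i f x + partial i g x).
  by move=> Ax; apply: dvD; [exact: class_C_dv Cf Ax|exact: class_C_dv Cg Ax].
split=> [x Ax|i].
  by apply: continuousD; [exact: class_C_cont Cf Ax|exact: class_C_cont Cg Ax].
split=> [x Ax|]; first by have [] := D i x Ax.
apply: (@class_C_eq _ _ (fun x => partial i f x + partial i g x)) => //.
  by move=> x Ax; have /dv_val := D i x Ax.
by apply: IH; exact: class_C_partial.
Qed.

Lemma class_CZ k A f c : open A -> class_C k A f -> class_C k A (fun y => c * f y).
Proof.
move=> oA; elim: k f => [|k IH] f Cf.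
  split=> // x Ax; apply: continuousM; first exact: cst_continuous.
  exact: class_C_cont Cf Ax.
have D i x : A x -> dv x (ei i) (fun y => c * f y) (c * partial i f x).
  by move=> Ax; apply: dvZ; exact: class_C_dv Cf Ax.
split=> [x Ax|i].
  apply: continuousM; first exact: cst_continuous.
  exact: class_C_cont Cf Ax.
split=> [x Ax|]; first by have [] := D i x Ax.
apply: (@class_C_eq _ _ (fun x => c * partial i f x)) => //.
  by move=> x Ax; have /dv_val := D i x Ax.
by apply: IH; exact: class_C_partial.
Qed.

Lemma class_CB k A f g : open A -> class_C k A f -> class_C k A g ->
  class_C k A (fun y => f y - g y).
Proof.
move=> oA Cf Cg; apply: (@class_C_eq _ _ (fun y => f y + (-1) * g y)) => //.
  by move=> y _; rewrite mulN1r.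
by apply: class_CD => //; exact: class_CZ.
Qed.

Lemma class_C_cst k A c : class_C k A (fun _ : V => c).
Proof.
elim: k c => [|k IH] c; first by split=> // x _; exact: cst_continuous.
split=> [x _|i]; first exact: cst_continuous.
split=> [x _|]; first exact: derivable_cst.
rewrite (_ : partial i _ = fun=> 0) //.
by apply/funext => x; rewrite /partial derive_cst.
Qed.

Lemma class_C_sum k A m (h : 'I_m -> V -> R) : open A ->
  (forall i, class_C k A (h i)) -> class_C k A (fun y => \sum_(i < m) h i y).
Proof.
move=> oA; elim: m h => [|m IH] h Ch.
  apply: (@class_C_eq _ _ (fun=> 0)) => //; last exact: class_C_cst.
  by move=> y _; rewrite big_ord0.
apply: (@class_C_eq _ _ (fun y => (\sum_(i < m) h (widen_ord (leqnSn m) i) y) + h ord_max y)) => //.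
  by move=> y _; rewrite big_ord_recr.
by apply: class_CD => //; exact: IH.
Qed.

Lemma class_C_laplacian k A f : open A -> class_C k.+2 A f ->
  class_C k A (laplacian f).
Proof.
by move=> oA Cf; apply: class_C_sum => // i; do 2! apply: class_C_partial.
Qed.

Lemma laplacian_eq A f g x : open A -> (forall y, A y -> f y = g y) -> A x ->
  laplacian f x = laplacian g x.
Proof.
move=> oA fg Ax; apply: eq_bigr => i _; apply: (partial_eq _ oA) => // y Ay.
exact: (partial_eq _ oA).
Qed.

Lemma iter_laplacian_eq A m f g x : open A -> (forall y, A y -> f y = g y) -> A x ->
  iter m (@laplacian R n) f x = iter m (@laplacian R n) g x.
Proof.
move=> oA; elim: m x => [|m IH] x fg Ax; first exact: fg.
by rewrite !iterS; apply: (laplacian_eq oA) => // y Ay; exact: IH.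
Qed.

Lemma sec_class_C A f x i : open A -> class_C 2 A f -> A x ->
  sec x (ei i) f (partial i (partial i f) x).
Proof.
move=> oA Cf Ax; exists (partial i f).
  have := open_nbhs_nbhs (conj oA Ax); apply: filterS => y Ay.
  exact: class_C_dv Cf Ay.
exact: class_C_dv (class_C_partial i Cf) Ax.
Qed.

Lemma polyharmonic_laplacian m A f : open A -> polyharmonic m.+1 A f ->
  polyharmonic m A (laplacian f).
Proof.
move=> oA [Cf H]; split; last by move=> x /H; rewrite iterSr.
by apply: class_C_laplacian => //; move: Cf; rewrite mulnS.
Qed.

Lemma polyharmonic_sub m A B f : A `<=` B -> polyharmonic m B f -> polyharmonic m A f.
Proof.
by move=> AB [Cf H]; split; [exact: class_C_sub Cf|move=> x /AB; exact: H].
Qed.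

Lemma laplacianD A f g x : open A -> class_C 2 A f -> class_C 2 A g -> A x ->
  laplacian (fun y => f y + g y) x = laplacian f x + laplacian g x.
Proof.
move=> oA Cf Cg Ax; rewrite /laplacian -big_split; apply: eq_bigr => i _ /=.
have E y : A y -> partial i (fun y => f y + g y) y = partial i f y + partial i g y.
  move=> Ay; apply: dv_val; apply: dvD.
    exact: class_C_dv Cf Ay.
  exact: class_C_dv Cg Ay.
rewrite (partial_eq _ oA E Ax); apply: dv_val; apply: dvD.
  exact: class_C_dv (class_C_partial i Cf) Ax.
exact: class_C_dv (class_C_partial i Cg) Ax.
Qed.

Lemma laplacianZ A f c x : open A -> class_C 2 A f -> A x ->
  laplacian (fun y => c * f y) x = c * laplacian f x.
Proof.
move=> oA Cf Ax; rewrite /laplacian mulr_sumr; apply: eq_bigr => i _ /=.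
have E y : A y -> partial i (fun y => c * f y) y = c * partial i f y.
  by move=> Ay; apply: dv_val; apply: dvZ; exact: class_C_dv Cf Ay.
rewrite (partial_eq _ oA E Ax); apply: dv_val; apply: dvZ.
exact: class_C_dv (class_C_partial i Cf) Ax.
Qed.

Lemma class_C_iter_laplacian k m A f : open A -> class_C (2 * m + k) A f ->
  class_C k A (iter m (@laplacian R n) f).
Proof.
move=> oA; elim: m f => // m IH f Cf; rewrite iterSr; apply: IH.
by apply: class_C_laplacian => //; move: Cf; rewrite mulnS !addSn.
Qed.

Lemma polyharmonicD m A f g : open A -> polyharmonic m A f -> polyharmonic m A g ->
  polyharmonic m A (fun y => f y + g y).
Proof.
move=> oA [Cf Hf] [Cg Hg]; split; first exact: class_CD.
move=> x Ax; rewrite -[RHS]addr0 -{1}(Hf x Ax) -(Hg x Ax).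
elim: m x Ax f g Cf Cg {Hf Hg} => // m IH x Ax f g Cf Cg.
rewrite !iterSr -IH//; last 2 first.
- by apply: class_C_laplacian => //; move: Cf; rewrite mulnS.
- by apply: class_C_laplacian => //; move: Cg; rewrite mulnS.
apply: (iter_laplacian_eq _ oA) => // y Ay; apply: (laplacianD oA) => //.
  by apply: class_C_le Cf; rewrite mulnS.
by apply: class_C_le Cg; rewrite mulnS.
Qed.

Lemma polyharmonicZ m A f c : open A -> polyharmonic m A f ->
  polyharmonic m A (fun y => c * f y).
Proof.
move=> oA [Cf Hf]; split; first exact: class_CZ.
move=> x Ax; rewrite -[RHS](mulr0 c) -(Hf x Ax).
elim: m x Ax f Cf {Hf} => // m IH x Ax f Cf.
rewrite !iterSr -IH//; last first.
  by apply: class_C_laplacian => //; move: Cf; rewrite mulnS.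
apply: (iter_laplacian_eq _ oA) => // y Ay; apply: (laplacianZ _ oA) => //.
by apply: class_C_le Cf; rewrite mulnS.
Qed.

Lemma partial_shift f i (h : V) x :
  partial i (fun y => f (y + h)) x = partial i f (x + h).
Proof.
rewrite /partial /derive.
have -> : (fun t : R => t^-1 *: (((fun y => f (y + h)) \o shift x) (t *: ei i) - f (x + h))) =
    (fun t => t^-1 *: ((f \o shift (x + h)) (t *: ei i) - f (x + h))).
  by apply/funext => t /=; rewrite addrA.
by [].
Qed.

Lemma laplacian_shift f (h : V) :
  laplacian (fun y => f (y + h)) = fun x => laplacian f (x + h).
Proof.
apply/funext => x; apply: eq_bigr => i _.
by rewrite (_ : partial i (fun y => f (y + h)) = fun y => partial i f (y + h));
  [rewrite partial_shift|apply/funext => y; rewrite partial_shift].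
Qed.

Lemma class_C_shift k A f (h : V) : class_C k A f ->
  class_C k [set y | A (y + h)] (fun y => f (y + h)).
Proof.
have cs g : (forall x, A x -> {for x, continuous g}) ->
    forall x, A (x + h) -> {for x, continuous (fun y => g (y + h))}.
  move=> cg x Ax; apply/contE => e e0.
  have [d d0 Hd] := (contE _ _).1 (cg _ Ax) e e0; exists d => // y yd.
  by apply: Hd; rewrite opprD addrACA subrr addr0.
elim: k f => [|k IH] f [cf H]; first by split=> //; exact: cs.
split=> [|i]; first exact: cs.
have [df Cf] := H i; split.
  move=> x Ax; have /dvP D := derivableP (df _ Ax).
  have [] // : dv x (ei i) (fun y => f (y + h)) ('D_(ei i) f (x + h)).
  apply/dvP => e e0; have [d d0 Hd] := D e e0; exists d => // t t0 td.
  by rewrite -addrA; exact: Hd.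
rewrite (_ : partial i (fun y => f (y + h)) = fun y => partial i f (y + h)).
  exact: IH.
by apply/funext => y; rewrite partial_shift.
Qed.

Lemma polyharmonic_shift m A f (h : V) : polyharmonic m A f ->
  polyharmonic m [set y | A (y + h)] (fun y => f (y + h)).
Proof.
move=> [Cf Hf]; split; first exact: class_C_shift.
move=> x Ax; rewrite -(Hf _ Ax); elim: m f {Cf Hf} => [f|m IH f]; first exact: erefl.
by rewrite iterSr laplacian_shift IH -iterSr.
Qed.

End class_C_theory.

(** * Cubes and barriers *)

Section cubes.
Context {R : realType} {n : nat}.
Local Notation V := 'rV[R]_n.
Local Notation ei i := (delta_mx (ord0 : 'I_1) i : V).
Implicit Types (x y z : V) (d r : R).

(** Cubes are invariant under reflection in the coordinate hyperplanes through their centre and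
    contain the coordinate paths between their points. *)
Definition cube x d : set V := [set y | `|y - x| <= d].

Lemma cubeP x d y : 0 <= d -> cube x d y <-> forall i, `|y ord0 i - x ord0 i| <= d.
Proof.
by move=> d0; rewrite /cube /= rv_norm_le//; split=> H i; have := H i; rewrite !mxE.
Qed.

Lemma cube_entry x d y i : cube x d y -> `|y ord0 i - x ord0 i| <= d.
Proof. by move=> H; have := entry_le (y - x) i; rewrite !mxE => /le_trans; apply. Qed.

Lemma closed_cube x d : closed (cube x d).
Proof.
rewrite (_ : cube x d = closed_ball_ Num.norm x d); first exact: closed_closed_ball_.
by apply/seteqP; split=> y; rewrite /cube /closed_ball_ /= distrC.
Qed.

Lemma compact_cube x d : compact (cube x d).
Proof.
apply: bounded_closed_compact; last exact: closed_cube.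
exists (`|x| + d); split; first exact: num_real.
move=> M HM y Hy /=; rewrite (le_trans _ (ltW HM))// -[y](subrK x).
by rewrite (le_trans (ler_normD _ _))// addrC lerD2l.
Qed.

Lemma cube_center x d : 0 <= d -> cube x d x.
Proof. by move=> d0; rewrite /cube /= subrr normr0. Qed.

Lemma cube_sub x d y r : `|y - x| + r <= d -> cube y r `<=` cube x d.
Proof.
move=> H z; rewrite /cube /= => zr; apply: le_trans H.
by apply: le_trans (ler_distD y z x) _; rewrite [leRHS]addrC lerD2r.
Qed.

Lemma continuous_entry (i : 'I_n) : continuous (fun y : V => y ord0 i).
Proof. exact: coord_continuous. Qed.

(** The squared Euclidean distance: unlike the sup norm it is a polynomial, with constant Laplacian
    2n. The two are compared in [sqd_lower] and [sqd_upper], at the price of a factor n. *)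
Definition sqd z (y : V) : R := \sum_(i < n) (y ord0 i - z ord0 i) ^+ 2.

Lemma dv_sq z x (i j : 'I_n) :
  dv x (ei j) (fun y => (y ord0 i - z ord0 i) ^+ 2)
    (2 * (x ord0 i - z ord0 i) * (i == j)%:R).
Proof.
rewrite (_ : (fun _ => _) = fun y => (y ord0 i - z ord0 i) * (y ord0 i - z ord0 i)).
  apply: dv_eq.
    by apply: dvM; (apply: dvB; [exact: dv_entry|exact: dv_cst]).
  by rewrite subr0; ring.
by apply/funext => y; rewrite expr2.
Qed.

Lemma dv_sqd z x (j : 'I_n) : dv x (ei j) (sqd z) (2 * (x ord0 j - z ord0 j)).
Proof.
apply: dv_eq; first by apply: dv_sum => i; exact: dv_sq.
rewrite (bigD1 j)//= eqxx mulr1 big1 ?addr0// => i /negPf ->.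
by rewrite mulr0.
Qed.

Lemma sec_sq z x (i j : 'I_n) :
  sec x (ei j) (fun y => (y ord0 i - z ord0 i) ^+ 2) (2 * (i == j)%:R).
Proof.
exists (fun x => 2 * (x ord0 i - z ord0 i) * (i == j)%:R).
  by apply: filterE => y; exact: dv_sq.
apply: dv_eq.
  apply: dvM; last exact: dv_cst.
  by apply: dvZ; apply: dvB; [exact: dv_entry|exact: dv_cst].
by case: (i == j); rewrite /= ?mulr1n ?mulr0n ?subr0; ring.
Qed.

Lemma sec_entry z x (i j : 'I_n) : sec x (ei j) (fun y => y ord0 i - z ord0 i) 0.
Proof.
exists (fun=> (i == j)%:R); last exact: dv_cst.
apply: filterE => y; apply: dv_eq.
  by apply: dvB; [exact: dv_entry|exact: dv_cst].
by rewrite subr0.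
Qed.

Lemma sec_sqd z x (j : 'I_n) : sec x (ei j) (sqd z) 2.
Proof.
exists (fun y => 2 * (y ord0 j - z ord0 j)).
  by apply: filterE => y; exact: dv_sqd.
apply: dv_eq; first by apply: dvZ; apply: dvB; [exact: dv_entry|exact: dv_cst].
by rewrite eqxx subr0 mulr1.
Qed.

Lemma sqd_ge0 z x : 0 <= sqd z x.
Proof. by apply: sumr_ge0 => i _; rewrite sqr_ge0. Qed.

Lemma sqd_lower z x : `|x - z| ^+ 2 <= sqd z x.
Proof.
have H (i : 'I_n) : (x ord0 i - z ord0 i) ^+ 2 <= sqd z x.
  by rewrite /sqd (bigD1 i)//= lerDl; apply: sumr_ge0 => k _; rewrite sqr_ge0.
rewrite -[leRHS]sqr_sqrtr ?sqd_ge0// lerXn2r ?nnegrE ?sqrtr_ge0//.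
apply/rv_norm_le; rewrite ?sqrtr_ge0// => i; rewrite !mxE.
by rewrite -sqrtr_sqr ler_sqrt ?sqd_ge0.
Qed.

Lemma sqd_upper z x d : `|x - z| <= d -> sqd z x <= n%:R * d ^+ 2.
Proof.
move=> H; rewrite -[n in n%:R]card_ord mulr_natl -sumr_const; apply: ler_sum => i _.
rewrite -real_normK ?num_real// lerXn2r ?nnegrE//; first exact: le_trans H.
exact: cube_entry.
Qed.

Lemma sqd_gt0 z x : x != z -> 0 < sqd z x.
Proof.
move=> xz; apply: lt_le_trans (sqd_lower z x).
by rewrite exprn_gt0// normr_gt0 subr_eq0.
Qed.

Lemma continuous_sqd z : continuous (sqd z).
Proof.
have H m (h : 'I_m -> V -> R) : (forall i, continuous (h i)) ->
    continuous (fun y => \sum_(i < m) h i y).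
  elim: m h => [|m IH] h ch x.
    rewrite (_ : (fun _ => _) = cst 0); first exact: cst_continuous.
    by apply/funext => y; rewrite big_ord0.
  rewrite (_ : (fun _ => _) = fun y => (\sum_(i < m) h (widen_ord (leqnSn m) i) y)
      + h ord_max y); last by apply/funext => y; rewrite big_ord_recr.
  by apply: continuousD; [exact: IH|exact: ch].
apply: H => i x; rewrite (_ : (fun _ => _) =
    fun y : V => (y ord0 i - z ord0 i) * (y ord0 i - z ord0 i)).
  by apply: (@continuousM _ _ (fun y : V => y ord0 i - z ord0 i) (fun y : V => y ord0 i - z ord0 i)); apply: (@continuousB _ _ _ (fun y : V => y ord0 i) (fun=> z ord0 i));
    [exact: continuous_entry|exact: cst_continuous
    |exact: continuous_entry|exact: cst_continuous].
by apply/funext => y; rewrite expr2.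
Qed.

End cubes.

Section barrier.
Context {R : realType}.

(* [G (|y|^2)] is a radial harmonic function which is decreasing in [|y|] and
   has a pole at the origin. *)
Record barrier (n : nat) (G : R -> R) : Prop := Barrier {
  barrier_harmonic : exists G1 G2 : R -> R, forall s : R, 0 < s ->
    [/\ dv s 1 G (G1 s), dv s 1 G1 (G2 s) & 4 * s * G2 s + 2 * n%:R * G1 s = 0];
  barrier_decr : forall s t : R, 0 < s -> s <= t -> G t <= G s;
  barrier_pole : forall M, exists2 d : R, 0 < d & forall s : R, 0 < s -> s < d -> M <= G s }.

Variables (n : nat) (G : R -> R).
Hypothesis barG : barrier n G.
Local Notation V := 'rV[R]_n.
Local Notation ei i := (delta_mx (ord0 : 'I_1) i : V).

(** By the chain rule the second derivative in direction i is 4 (x_i - z_i)^2 G2 + 2 G1 at s = |x -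
    z|^2; summed over i this is the left side of the equation in [barrier_harmonic]. *)
Lemma sec_barrier (z x : V) : x != z ->
  exists2 l : 'I_n -> R, (forall i, sec x (ei i) (fun y => G (sqd z y)) (l i)) &
    \sum_i l i = 0.
Proof.
move=> xz; have [G1 [G2 H]] := barrier_harmonic barG.
exists (fun i => G2 (sqd z x) * (2 * (x ord0 i - z ord0 i)) ^+ 2
   + G1 (sqd z x) * 2).
  move=> i; exists (fun y => G1 (sqd z y) * (2 * (y ord0 i - z ord0 i))).
    have := open_nbhs_nbhs (conj (open_setD1 z openT) (conj I (elimN eqP xz))).
    apply: filterS => y [_ /eqP yz]; apply: dv_comp; first exact: dv_sqd.
    by have [] := H _ (sqd_gt0 yz).
  apply: dv_eq.
    apply: dvM.
      apply: dv_comp; first exact: dv_sqd.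
      have [_ D _] := H _ (sqd_gt0 xz); exact: D.
    by apply: dvZ; apply: dvB; [exact: dv_entry|exact: dv_cst].
  by rewrite eqxx subr0 mulr1; ring.
rewrite big_split /= sumr_const card_ord -mulr_sumr.
under eq_bigr do rewrite exprMn.
rewrite -mulr_sumr -/(sqd z x) -mulr_natl.
have [_ _ E] := H _ (sqd_gt0 xz).
by rewrite -[RHS]E; ring.
Qed.

Lemma continuous_barrier (z x : V) : x != z -> {for x, continuous (fun y => G (sqd z y))}.
Proof.
move=> xz; apply: (@continuous_comp _ _ _ (sqd z) G); first exact: continuous_sqd.
have [G1 [G2 H]] := barrier_harmonic barG.
have [[D _] _ _] := H _ (sqd_gt0 xz).
exact/differentiable_continuous/derivable1_diffP.
Qed.

End barrier.

(** * The gradient bound *)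

Lemma open_sublevel (R : realType) (T : topologicalType) (f : T -> R) (r : R) :
  continuous f -> open [set y | f y < r].
Proof.
move=> cf; apply: (@open_comp _ _ f [set a | a < r]); last exact: open_lt.
by move=> y _; exact: cf.
Qed.

Lemma closed_superlevel (R : realType) (T : topologicalType) (f : T -> R) (r : R) :
  continuous f -> closed [set y | r <= f y].
Proof.
move=> cf; apply: (@closed_comp _ _ f [set a | r <= a]); last exact: closed_ge.
by move=> y _; exact: cf.
Qed.

Lemma isometry_continuous (R : realType) (V : normedModType R) (sg : V -> V) :
  (forall y z, `|sg y - sg z| = `|y - z|) -> continuous sg.
Proof.
move=> H y; apply/cvgrPdist_lt => e e0; apply/nbhs_norm_ltP; exists e => // z ze.
by rewrite H distrC.
Qed.

Lemma rv_subE (R : realType) (n : nat) (a b : 'rV[R]_n) j :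
  (a - b) ord0 j = a ord0 j - b ord0 j.
Proof. by rewrite !mxE. Qed.

(** * Reflections in coordinate hyperplanes *)

Section reflection.
Context {R : realType} {n : nat}.
Local Notation V := 'rV[R]_n.
Local Notation ei i := (delta_mx (ord0 : 'I_1) i : V).
Variables (x : V) (i : 'I_n).

Definition refl (y : V) : V := (- (2 * (y ord0 i - x ord0 i))) *: ei i + y.

Lemma refl_entry y j : refl y ord0 j =
  if i == j then 2 * x ord0 j - y ord0 j else y ord0 j.
Proof.
rewrite line_entry; case: eqP => [<-|_]; rewrite ?mulr0 ?addr0// mulr1; ring.
Qed.

Lemma reflK : involutive refl.
Proof.
move=> y; apply/rowP => j; rewrite !refl_entry; case: (i == j) => //; ring.
Qed.

Lemma refl_norm y z : `|refl y - refl z| = `|y - z|.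
Proof.
have H (a b : V) : `|refl a - refl b| <= `|a - b|.
  apply/rv_norm_le => // j; rewrite rv_subE !refl_entry.
  have Hj : `|a ord0 j - b ord0 j| <= `|a - b|.
    by have := entry_le (a - b) j; rewrite rv_subE.
  case: (i == j) => //.
  rewrite (_ : _ - _ = b ord0 j - a ord0 j) 1?distrC//; ring.
by apply/eqP; rewrite eq_le H -{1}[y]reflK -{1}[z]reflK H.
Qed.

Lemma refl_center : refl x = x.
Proof. by rewrite /refl subrr mulr0 oppr0 scale0r add0r. Qed.

Lemma continuous_refl : continuous refl.
Proof. exact: (isometry_continuous refl_norm). Qed.

Lemma refl_dir y (t : R) j :
  refl (t *: ei j + y) = t *: (if i == j then - ei j else ei j) + refl y.
Proof.
apply/rowP => k; rewrite refl_entry line_entry.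
have [<-|ij] := eqVneq i j.
  rewrite scalerN -scaleNr line_entry refl_entry; case: (i == k) => /=; ring.
rewrite line_entry refl_entry; case: (eqVneq i k) => [<-|//].
by rewrite eq_sym (negPf ij) !mulr0 !addr0.
Qed.

(** The reflection reverses one coordinate direction and keeps the others; a second derivative does
    not see the sign. *)
Lemma sec_refl y u (l : R) j : sec (refl y) (ei j) u l ->
  sec y (ei j) (fun y => u (refl y)) l.
Proof.
move=> H; apply: (sec_affine continuous_refl (fun y t => refl_dir y t j)).
by case: (i == j) => //; exact: sec_opp_dir.
Qed.

End reflection.

(** The Laplacian of the comparison function at a positive maximum: K outweighs the two values of
    Delta u, and e makes the inequality strict. *)
Lemma half_difference_gt (R : realFieldType) (a b K e : R) : 0 < e ->
  `|a| <= K -> `|b| <= K -> 0 < 2^-1 * (a - b) - - (K + e) - 0.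
Proof.
by move=> e0; rewrite !ler_norml => /andP[a1 a2] /andP[a3 a4]; lra.
Qed.

Section gradient_bound.
Context {R : realType} {n : nat}.
Local Notation V := 'rV[R]_n.
Local Notation ei i := (delta_mx (ord0 : 'I_1) i : V).

(** With t = y_i - x_i, the function t (d - t) vanishes on the hyperplane t = 0, is nonnegative for
    0 <= t <= d, and its negative second derivative pays for Delta u. *)
Lemma sec_slab (x y : V) (i j : 'I_n) (d : R) :
  sec y (ei j) (fun y => (y ord0 i - x ord0 i) * (d - (y ord0 i - x ord0 i)))
    (- (2 * (i == j)%:R)).
Proof.
rewrite (_ : (fun _ => _) = fun y : V => d * (y ord0 i - x ord0 i)
    - (y ord0 i - x ord0 i) ^+ 2); last by apply/funext => {}y; ring.
apply: sec_eq.
  by apply: secB; [apply: secZ; exact: sec_entry|exact: sec_sq].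
by rewrite mulr0 add0r.
Qed.

Variables (G : R -> R).
Hypothesis barG : barrier n G.

Section comparison.
Variables (A : set V) (z x : V) (u : V -> R) (d M K : R) (i : 'I_n).
Hypotheses (oA : open A) (Cu : class_C 2 (A `\ z) u) (d0 : 0 < d)
  (xA : cube x d `<=` A) (xz : x != z).
Hypothesis uM : forall y, cube x d y -> y != z -> `|u y| <= M.
Hypothesis uK : forall y, cube x d y -> y != z -> `|laplacian u y| <= K.

Let zr := refl x i z.
(** An upper bound on the cube for the squared distances to [z] and to [zr], so that both functions
    [bar] are nonnegative there. *)
Let S := n%:R * (d + `|x - z|) ^+ 2.
Let bar (c y : V) := G (sqd c y) - G S.
Let t (y : V) := y ord0 i - x ord0 i.
(** Chosen so that the comparison polynomial in [w] has Laplacian 2 n M / d^2 - 2 gam = - (K +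
    e). *)
Let gam (e : R) := n%:R * M / d ^+ 2 + (K + e) / 2.
Let w (e : R) y := 2^-1 * (u y - u (refl x i y))
  - (M / d ^+ 2 * sqd x y + gam e * (t y * (d - t y)))
  - e * (bar z y + bar zr y).

Let M0 : 0 <= M.
Proof. exact: le_trans (normr_ge0 _) (uM (cube_center _ (ltW d0)) xz). Qed.

Let K0 : 0 <= K.
Proof. exact: le_trans (normr_ge0 _) (uK (cube_center _ (ltW d0)) xz). Qed.

Let refl_cube y : cube x d y -> cube x d (refl x i y).
Proof. by rewrite /cube /=; have := refl_norm x i y x; rewrite refl_center => ->. Qed.

Let bar_ge0 (c y : V) : cube x d y -> c = z \/ c = zr -> y != c -> 0 <= bar c y.
Proof.
move=> cy Hc yc; rewrite subr_ge0; apply: (barrier_decr barG); first exact: sqd_gt0.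
apply: sqd_upper.
have H (a : V) : cube x d a -> `|a - z| <= d + `|x - z|.
  by move=> Ha; apply: le_trans (ler_distD x _ _) _; rewrite lerD2r.
case: Hc => ->; first exact: H.
by rewrite -(refl_norm x i) /zr reflK; apply: H; exact: refl_cube.
Qed.

Let gam_ge0 e : 0 < e -> 0 <= gam e.
Proof.
by move=> e0; rewrite addr_ge0 ?divr_ge0 ?mulr_ge0 ?ler0n ?exprn_ge0 ?addr_ge0 ?(ltW d0) ?(ltW e0).
Qed.

(* On the half cube [t y >= 0] the odd part of [u] is compared with a quadratic
   polynomial that dominates it on the boundary; the two barriers take care of
   [z] and of its mirror image. *)
Lemma gradient_comparison e y : 0 < e -> cube x d y -> 0 <= t y ->
  y != z -> y != zr -> w e y <= 0.
Proof.
move=> e0 cy ty yz yzr.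
(* At squared distance below [del] from a pole, e times its barrier is at least M. Taking the
   minimum with the squared distances of [y] itself leaves [y] outside [N]. *)
have [del del0 Hdel] := barrier_pole barG (M / e + G S).
pose r := Num.min del (Num.min (sqd z y) (sqd zr y)).
have r0 : 0 < r by rewrite !lt_min del0 !sqd_gt0.
pose N := [set y | sqd z y < r] `|` [set y | sqd zr y < r].
have oN : open N.
  by apply: openU; apply: open_sublevel; exact: continuous_sqd.
pose H := cube x d `&` [set y | x ord0 i <= y ord0 i].
have cH : compact H.
  apply: compact_closedI; first exact: compact_cube.
  by apply: closed_superlevel; exact: continuous_entry.
have NNz y' : ~ N y' -> y' != z /\ y' != zr.
  move=> Ny'; split; apply/eqP => E; apply: Ny'; [left|right]; rewrite /= E;
  by rewrite /sqd big1 // => k _; rewrite subrr expr0n.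
have Ny : ~ N y.
  by rewrite /N /= => -[]; rewrite /r !lt_min ltxx ?andbF.
have cu y' : cube x d y' -> y' != z -> {for y', continuous u}.
  by move=> /xA Ay /eqP yz'; apply: (class_C_cont Cu).
have zr_refl y' : y' != zr -> refl x i y' != z.
  by apply: contra => /eqP E; rewrite /zr -E reflK.
have cw y' : cube x d y' -> y' != z -> y' != zr -> {for y', continuous (w e)}.
  move=> cy' yz' yzr'.
  have ct : {for y', continuous t}.
    by apply: continuousB; [exact: continuous_entry|exact: cst_continuous].
  have cb c : y' != c -> {for y', continuous (bar c)}.
    move=> yc; apply: (@continuousB _ _ _ (fun y => G (sqd c y)) (fun=> G S)).
      exact: (continuous_barrier barG yc).
    exact: cst_continuous.
  apply: continuousB; first apply: continuousB.
  - apply: continuousM; first exact: cst_continuous.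
    apply: continuousB; first exact: cu.
    apply: (@continuous_comp _ _ _ (refl x i) u); first exact: continuous_refl.
    by apply: cu; [exact: refl_cube|exact: zr_refl].
  - apply: continuousD.
      by apply: continuousM; [exact: cst_continuous|exact: continuous_sqd].
    apply: continuousM; first exact: cst_continuous.
    by apply: continuousM => //; apply: continuousB => //; exact: cst_continuous.
  - apply: continuousM; first exact: cst_continuous.
    by apply: continuousD; exact: cb.
(* Drops the slab term, which is nonnegative on the half cube; this cruder bound settles the outer
   faces and the neighbourhood of the poles. *)
have w_le y' : cube x d y' -> 0 <= t y' -> y' != z -> y' != zr ->
    w e y' <= M - M / d ^+ 2 * sqd x y' - e * (bar z y' + bar zr y').
  move=> cy' ty' yz' yzr'.
  rewrite /w lerD2r lerB//.
    have h1 := uM cy' yz'; have h2 := uM (refl_cube cy') (zr_refl _ yzr').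
    move: h1 h2; rewrite !ler_norml => /andP[a1 a2] /andP[a3 a4]; lra.
  rewrite lerDl !mulr_ge0 ?gam_ge0// subr_ge0.
  by apply: le_trans (ler_norm _) _; exact: cube_entry.
apply: (max_principle cH oN _ _ (conj cy _) Ny); last by rewrite /= -subr_ge0.
- by move=> y' [cy' _] /NNz[yz' yzr']; exact: cw.
move=> y' [cy'] /=; rewrite -subr_ge0 -/(t y') => ty' Ny' wy'.
have [yz' yzr'] := NNz _ Ny'.
have b1 := bar_ge0 cy' (or_introl erefl) yz'.
have b2 := bar_ge0 cy' (or_intror erefl) yzr'.
split; last first.
  have [l1 s1 E1] := sec_barrier barG yz'.
  have [l2 s2 E2] := sec_barrier barG yzr'.
  pose U j := partial j (partial j u).
  have secU j c : cube x d c -> c != z -> sec c (ei j) u (U j c).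
    move=> cc /eqP cz; apply: (sec_class_C j (open_setD1 _ oA) Cu).
    by split=> //; exact: xA.
  exists (fun j => 2^-1 * (U j y' - U j (refl x i y'))
      - (M / d ^+ 2 * 2 + gam e * (- (2 * (i == j)%:R)))
      - e * (l1 j - 0 + (l2 j - 0))).
    move=> j; apply: secB; first apply: secB.
    - apply: secZ; apply: secB; first exact: secU.
      by apply: sec_refl; apply: secU; [exact: refl_cube|exact: zr_refl].
    - apply: secD; apply: secZ; first exact: sec_sqd.
      exact: sec_slab.
    - by apply: secZ; apply: secD; apply: secB => //; exact: sec_cst.
  have S1 : \sum_j 2^-1 * (U j y' - U j (refl x i y')) =
      2^-1 * (laplacian u y' - laplacian u (refl x i y')).
    by rewrite -mulr_sumr sumrB.
  have S2 : \sum_j (M / d ^+ 2 * 2 + gam e * (- (2 * (i == j)%:R))) = - (K + e).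
    rewrite big_split /= sumr_const card_ord -mulr_sumr sumrN -mulr_sumr.
    rewrite (bigD1 i)//= eqxx big1 ?addr0; last first.
      by move=> j /negPf; rewrite eq_sym => ->.
    by rewrite mulr1 /gam -mulr_natl; field; rewrite gt_eqF.
  have S3 : \sum_j e * (l1 j - 0 + (l2 j - 0)) = 0.
    rewrite -mulr_sumr big_split /= !sumrB E1 E2 !big1//.
    by rewrite !subr0 addr0 mulr0.
  rewrite !sumrB S1 S2 S3.
  apply: half_difference_gt e0 _ _; first exact: uK.
  by apply: uK; [exact: refl_cube|exact: zr_refl].
(* On the outer faces |y' - x|^2 >= d^2, so the term with M / d^2 alone outweighs M. *)
have yd : `|y' - x| < d.
  rewrite lt_neqAle cy' andbT; apply/eqP => E.
  move: wy'; apply/negP; rewrite -leNgt; apply: le_trans (w_le _ cy' ty' yz' yzr') _.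
  rewrite subr_le0 (@le_trans _ _ 0)//; last by apply: mulr_ge0; [exact: ltW|exact: addr_ge0].
  rewrite subr_le0 mulrAC ler_pdivlMr ?exprn_gt0// ler_wpM2l// -E.
  exact: sqd_lower.
(* On the hyperplane t = 0 the reflection fixes y', so the odd part of [u] vanishes. *)
have yt : 0 < t y'.
  rewrite lt_neqAle ty' andbT; apply/eqP => E.
  move: wy'; apply/negP; rewrite -leNgt.
  have -> : w e y' = - (M / d ^+ 2 * sqd x y' + e * (bar z y' + bar zr y')).
    rewrite /w -E (_ : refl x i y' = y'); first ring.
    by rewrite /refl -/(t y') -E mulr0 oppr0 scale0r add0r.
  rewrite oppr_le0; apply: addr_ge0.
    by rewrite mulr_ge0 ?sqd_ge0 ?divr_ge0 ?exprn_ge0 ?(ltW d0).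
  by apply: mulr_ge0; [exact: ltW|exact: addr_ge0].
have near_ne (c : V) : y' != c -> \forall y \near y', y != c.
  move=> /eqP yc.
  have := open_nbhs_nbhs (conj (open_setD1 c openT) (conj I yc)).
  by apply: filterS => a [_ /eqP].
have near_d : \forall y \near y', `|y - x| < d.
  apply/nbhs_norm_ltP; exists (d - `|y' - x|); first by rewrite subr_gt0.
  by move=> a; rewrite ltrBrDr; apply: le_lt_trans; exact: ler_distD.
have near_t : \forall y \near y', 0 < t y.
  apply/nbhs_norm_ltP; exists (t y'); first exact: yt.
  move=> a ha.
  have : `|a ord0 i - y' ord0 i| < t y'.
    by apply: le_lt_trans ha; rewrite -rv_subE entry_le.
  rewrite ltr_norml => /andP[h _]; rewrite /t in h *; lra.
near=> a.
have ad : cube x d a by apply: ltW; near: a.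
have at0 : 0 <= t a by apply: ltW; near: a.
split; first by split=> //=; rewrite -subr_ge0.
have az : a != z by near: a; exact: near_ne.
have azr : a != zr by near: a; exact: near_ne.
move=> Na; apply: le_trans (w_le _ ad at0 az azr) _.
have c1 := bar_ge0 ad (or_introl erefl) az.
have c2 := bar_ge0 ad (or_intror erefl) azr.
suff : M <= e * (bar z a + bar zr a).
  have : 0 <= M / d ^+ 2 * sqd x a by rewrite mulr_ge0 ?sqd_ge0 ?divr_ge0 ?exprn_ge0 ?(ltW d0).
  lra.
have big c : a != c -> sqd c a < r -> M <= e * bar c a.
  move=> ac ar; rewrite mulrC -ler_pdivrMr// lerBrDr; apply: Hdel; first exact: sqd_gt0.
  by apply: lt_le_trans ar _; rewrite ge_min lexx.
rewrite mulrDr; case: Na => Na.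
  by apply: le_trans (big _ az Na) _; rewrite lerDl; apply: mulr_ge0 => //; exact: ltW.
by apply: le_trans (big _ azr Na) _; rewrite lerDr; apply: mulr_ge0 => //; exact: ltW.
Unshelve. all: by end_near. Qed.

End comparison.

(** Evaluate the comparison at x + t e_i, let e tend to 0, divide by t and let t tend to 0: the
    symmetric difference quotient tends to the derivative, and the polynomial leaves gam(0) d, which
    is the bound. *)
Lemma partial_upper_bound (A : set V) (z x : V) (u : V -> R) (d M K : R) i :
  open A -> class_C 2 (A `\ z) u -> 0 < d -> cube x d `<=` A -> x != z ->
  (forall y, cube x d y -> y != z -> `|u y| <= M) ->
  (forall y, cube x d y -> y != z -> `|laplacian u y| <= K) ->
  partial i u x <= n%:R * M / d + K * d / 2.
Proof.
move=> oA Cu d0 xA xz uM uK.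
pose zr := refl x i z.
pose g0 := n%:R * M / d ^+ 2 + K / 2.
have M0 : 0 <= M.
  exact: le_trans (normr_ge0 _) (uM _ (cube_center _ (ltW d0)) xz).
have xz0 : 0 < `|x - z| by rewrite normr_gt0 subr_eq0.
have line t : 0 < t -> t < d -> t < `|x - z| ->
    2^-1 * (u (t *: ei i + x) - u ((- t) *: ei i + x)) <=
    M / d ^+ 2 * t ^+ 2 + g0 * (t * (d - t)).
  move=> t0 td tz; set y := t *: ei i + x.
  have yi : y ord0 i - x ord0 i = t by rewrite line_entry eqxx mulr1 addrC addKr.
  have yr : refl x i y = (- t) *: ei i + x.
    by rewrite /refl yi /y addrA -scalerDl; congr (_ *: _ + _); ring.
  have ne s : `|s| = t -> s *: ei i + x != z.
    move=> st; apply/eqP => E; move: tz; rewrite -E opprD addrCA subrr addr0.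
    by rewrite normrN norm_scale_ei st ltxx.
  have yz : y != z by apply: ne; rewrite gtr0_norm.
  have yzr : y != zr.
    apply/eqP => E; have := ne (- t); rewrite normrN gtr0_norm// => /(_ erefl).
    by rewrite -yr E /zr reflK eqxx.
  have sq : sqd x y = t ^+ 2.
    rewrite /sqd (bigD1 i)//= yi big1 ?addr0// => j ji.
    by rewrite line_entry eq_sym (negPf ji) mulr0 addr0 subrr expr0n.
  have cy : cube x d y by rewrite /cube /= addrK norm_scale_ei gtr0_norm// ltW.
  (* The coefficient of e: its share in [gam] and the two barriers, all fixed once y is. *)
  apply: (@le_eps_mul _ _ _ (2^-1 * (t * (d - t)) +
    (G (sqd z y) - G (n%:R * (d + `|x - z|) ^+ 2) +
     (G (sqd zr y) - G (n%:R * (d + `|x - z|) ^+ 2))))) => e e0.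
  have := gradient_comparison oA Cu d0 xA xz uM uK e0 cy.
  move=> /(_ i); rewrite yi => /(_ (ltW t0) yz yzr); rewrite yr sq -/zr subr_le0 lerBlDr.
  move/le_trans; apply.
  rewrite /g0; lra.
have := class_C_dv i Cu (conj (xA _ (cube_center _ (ltW d0))) (elimN eqP xz)).
move=> /dvP D.
apply: (@le_eps_mul _ _ _ (1 + M / d ^+ 2)) => e e0.
have [r r0 Hr] := D e e0.
pose m := Num.min (Num.min r d) (Num.min `|x - z| e).
have m0 : 0 < m by rewrite !lt_min r0 d0 xz0 e0.
have [t t0] : exists2 t, 0 < t & t < m.
  by exists (m / 2); rewrite ?divr_gt0// ltr_pdivrMr// ltr_pMr// ltr1n.
rewrite !lt_min => /andP[/andP[tr td] /andP[tz te]].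
have L := line t t0 td tz.
have := Hr t; rewrite gt_eqF// gtr0_norm// => /(_ isT tr).
have := Hr (- t); rewrite oppr_eq0 gt_eqF// normrN gtr0_norm// => /(_ isT tr).
set D1 := partial i u x; set ux := u x; move: L.
set u1 := u (t *: ei i + x); set u2 := u ((- t) *: ei i + x) => L.
rewrite !ltr_norml => /andP[+ _] /andP[+ _].
rewrite !ltrBrDr invrN mulNr -mulrN opprB ![t^-1 * _]mulrC !ltr_pdivlMr// => h2 h1.
have h : (D1 - e) * t < M / d ^+ 2 * t ^+ 2 + g0 * (t * (d - t)) by lra.
have {h} : D1 - e < M / d ^+ 2 * t + g0 * (d - t).
  rewrite -(ltr_pM2r t0); apply: lt_le_trans h _; rewrite le_eqVlt; apply/orP; left.
  by apply/eqP; ring.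
have : M / d ^+ 2 * t <= M / d ^+ 2 * e.
  by rewrite ler_wpM2l ?divr_ge0 ?exprn_ge0 ?(ltW d0)// ltW.
have K0 : 0 <= K.
  exact: le_trans (normr_ge0 _) (uK _ (cube_center _ (ltW d0)) xz).
have : g0 * (d - t) <= g0 * d.
  rewrite ler_wpM2l// ?addr_ge0 ?divr_ge0 ?mulr_ge0 ?ler0n ?exprn_ge0 ?(ltW d0)//.
  by rewrite gerBl ltW.
have -> : n%:R * M / d + K * d / 2 = g0 * d by rewrite /g0; field; rewrite gt_eqF.
lra.
Qed.

Lemma partial_bound (A : set V) (z x : V) (u : V -> R) (d M K : R) i :
  open A -> class_C 2 (A `\ z) u -> 0 < d -> cube x d `<=` A -> x != z ->
  (forall y, cube x d y -> y != z -> `|u y| <= M) ->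
  (forall y, cube x d y -> y != z -> `|laplacian u y| <= K) ->
  `|partial i u x| <= n%:R * M / d + K * d / 2.
Proof.
move=> oA Cu d0 xA xz uM uK.
have oAz := open_setD1 z oA.
have Ax : (A `\ z) x by split; [exact: xA (cube_center _ (ltW d0))|exact/eqP].
rewrite ler_norml (partial_upper_bound i oA Cu d0 xA xz uM uK) andbT lerNl.
have -> : - partial i u x = partial i (fun y => (-1) * u y) x.
  by rewrite -[LHS]mulN1r; apply: esym; apply: dv_val; apply: dvZ; exact: class_C_dv Cu Ax.
apply: (partial_upper_bound i oA _ d0 xA xz).
- exact: class_CZ.
- by move=> y cy yz; rewrite mulN1r normrN uM.
- move=> y cy yz; rewrite (laplacianZ _ oAz Cu); last by split; [exact: xA|exact/eqP].
  by rewrite mulN1r normrN uK.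
Qed.

End gradient_bound.

(** * Bounds from the Laplacian *)

Lemma continuous_dist (R : realType) (V : normedModType R) (z : V) :
  continuous (fun y : V => `|y - z|).
Proof.
move=> y; apply/contE => e e0; exists e => // a ae; apply: le_lt_trans ae.
by apply: le_trans (ler_dist_dist _ _) _; rewrite opprB addrA subrK.
Qed.

Section laplacian_bounds.
Context {R : realType} {n : nat}.
Local Notation V := 'rV[R]_n.
Local Notation ei i := (delta_mx (ord0 : 'I_1) i : V).

Lemma compact_bound (T : topologicalType) (H : set T) (f : T -> R) : compact H ->
  {within H, continuous f} -> exists M : R, forall y, H y -> `|f y| <= M.
Proof.
move=> cH cf; have /compact_bounded [M [_ HM]] := continuous_compact cf cH.
by exists (M + 1) => y Hy; apply: HM; rewrite ?ltrDl//; exists y.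
Qed.

Lemma near_neq (c y : V) : y != c -> \forall a \near y, a != c.
Proof.
move=> /eqP yc.
have := open_nbhs_nbhs (conj (open_setD1 c openT) (conj I yc)).
by apply: filterS => a [_ /eqP].
Qed.

Lemma near_cube (x y : V) (d : R) : `|y - x| < d -> \forall a \near y, `|a - x| < d.
Proof.
move=> yd; apply/nbhs_norm_ltP; exists (d - `|y - x|); first by rewrite subr_gt0.
by move=> a; rewrite ltrBrDr; apply: le_lt_trans; exact: ler_distD.
Qed.

(** For c > 0 subtract b |y - x|^2 with b = c / (4 n), half the value that would make the Laplacian
    bound vanish: c / 2 is left, so the difference has no interior maximum of the relevant kind, and
    u(x) <= M - b s^2 follows from the faces. *)
Lemma laplacian_ge_bound (A : set V) (x : V) (u : V -> R) (s M c : R) :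
  (0 < n)%N -> open A -> class_C 2 A u -> 0 < s -> cube x s `<=` A ->
  (forall y, cube x s y -> `|u y| <= M) ->
  (forall y, cube x s y -> c <= laplacian u y) ->
  c * s ^+ 2 <= 8 * n%:R * M.
Proof.
move=> n0 oA Cu s0 xA uM uc.
have nR : 0 < n%:R :> R by rewrite ltr0n.
have cx : cube x s x by apply: cube_center; exact: ltW.
have M0 : 0 <= M by apply: le_trans (uM x cx).
have [c0|c0] := lerP c 0.
  apply: (@le_trans _ _ 0); last by rewrite !mulr_ge0// ltW.
  by apply: mulr_le0_ge0 => //; apply: exprn_ge0; exact: ltW.
pose b := c / (4 * n%:R).
have b0 : 0 < b by rewrite divr_gt0 ?mulr_gt0.
pose w y := u y - b * sqd x y - (M - b * s ^+ 2).
have cw y : cube x s y -> {for y, continuous w}.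
  move=> cy; apply: continuousB; last exact: cst_continuous.
  apply: continuousB; first by apply: (class_C_cont Cu); exact: xA.
  by apply: continuousM; [exact: cst_continuous|exact: continuous_sqd].
have : w x <= 0.
  have o0 : open (set0 : set V) by exact: open0.
  apply: (max_principle (@compact_cube _ _ x s) o0 _ _ cx) => //.
    by move=> y cy _; exact: cw.
  move=> y cy _ wy; split.
    have ys : `|y - x| < s.
      rewrite lt_neqAle cy andbT; apply/eqP => E.
      have h1 := sqd_lower x y; rewrite E in h1.
      have := uM y cy; rewrite ler_norml => /andP[_ h2].
      have h3 : b * s ^+ 2 <= b * sqd x y by rewrite ler_wpM2l// ltW.
      by move: wy; apply/negP; rewrite -leNgt /w; lra.
    by have := near_cube ys; apply: filterS => a ha; split=> //; exact: ltW.
  exists (fun i => partial i (partial i u) y - b * 2 - 0).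
    move=> i; apply: secB; last exact: sec_cst.
    apply: secB; first by apply: (sec_class_C i oA Cu); exact: xA.
    by apply: secZ; exact: sec_sqd.
  rewrite !sumrB -/(laplacian u y) sumr_const card_ord big1// subr0 -[_ *+ n]mulr_natl.
  have -> : n%:R * (b * 2) = c / 2 by rewrite /b; field; rewrite gt_eqF.
  by have := uc y cy; lra.
rewrite /w.
have -> : sqd x x = 0 by rewrite /sqd big1// => i _; rewrite subrr expr0n.
have := uM x cx; rewrite ler_norml => /andP[h _] h2.
have {h h2} h : b * s ^+ 2 <= 2 * M by lra.
have -> : c * s ^+ 2 = 4 * n%:R * (b * s ^+ 2) by rewrite /b; field; rewrite gt_eqF.
have -> : 8 * n%:R * M = 4 * n%:R * (2 * M) by ring.
by rewrite ler_wpM2l// mulr_ge0// ltW.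
Qed.

Variables (G : R -> R).
Hypothesis barG : barrier n G.

(** With c = (K + 1) / 2 the function u + c |y - z|^2 has Laplacian at least 2 n c - K >= 1. It is
    compared with a constant plus e (G - G S), which dominates at the puncture; then e tends to
    0. *)
Lemma punctured_upper_bound (A : set V) (z : V) (u : V -> R) (d B K : R) :
  (0 < n)%N -> open A -> class_C 2 (A `\ z) u -> 0 < d -> cube z d `<=` A ->
  0 <= B -> (forall y, `|y - z| = d -> u y <= B) ->
  0 <= K -> (forall y, cube z d y -> y != z -> - K <= laplacian u y) ->
  (forall e : R, 0 < e -> exists2 r : R, 0 < r & forall y, y != z ->
     `|y - z| < r -> u y <= e * G (sqd z y)) ->
  forall y, cube z d y -> y != z -> u y <= B + (K + 1) / 2 * (n%:R * d ^+ 2).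
Proof.
move=> n0 oA Cu d0 zA B0 uB K0 uK uo y cy yz.
have nR : 1 <= n%:R :> R by rewrite ler1n.
pose c := (K + 1) / 2; pose S := n%:R * d ^+ 2.
have c0 : 0 < c by rewrite divr_gt0// ltr_wpDl.
have S0 : 0 < S by rewrite mulr_gt0 ?exprn_gt0// (lt_le_trans _ nR).
have sqS a : cube z d a -> sqd z a <= S by exact: sqd_upper.
apply: (@le_eps_mul _ _ _ (G (sqd z y) - G S)) => e e0.
(* Near z, u <= (e / 2) G, and this is at most e (G - G S) as soon as G >= 2 G S. *)
have [r1 r10 Hr1] := uo (e / 2) (divr_gt0 e0 (ltr0n _ 2)).
have [r2 r20 Hr2] := barrier_pole barG (2 * G S).
pose r := Num.min (Num.min (r1 ^+ 2) r2) (sqd z y).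
have r0 : 0 < r by rewrite !lt_min exprn_gt0// r20 sqd_gt0.
pose N := [set a | sqd z a < r].
have oN : open N by apply: open_sublevel; exact: continuous_sqd.
have Ny : ~ N y by rewrite /N /= /r !lt_min ltxx !andbF.
have Nz a : ~ N a -> a != z.
  move=> Na; apply/eqP => E; apply: Na; rewrite /N /= E.
  by rewrite /sqd big1 // => k _; rewrite subrr expr0n.
pose w a := u a + c * sqd z a - e * (G (sqd z a) - G S) - (B + c * S).
have bar0 a : cube z d a -> a != z -> 0 <= G (sqd z a) - G S.
  move=> ca az; rewrite subr_ge0; apply: (barrier_decr barG); first exact: sqd_gt0.
  exact: sqS.
suff : w y <= 0.
  have : 0 <= c * sqd z y by rewrite mulr_ge0 ?sqd_ge0// ltW.
  rewrite /w -/c -/S; lra.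
apply: (max_principle (@compact_cube _ _ z d) oN _ _ cy Ny).
  move=> a ca Na; have az := Nz a Na.
  apply: continuousB; last exact: cst_continuous.
  apply: continuousB; first apply: continuousD.
  - by apply: (class_C_cont Cu); split; [exact: zA|exact/eqP].
  - by apply: continuousM; [exact: cst_continuous|exact: continuous_sqd].
  - apply: continuousM; first exact: cst_continuous.
    apply: (@continuousB _ _ _ (fun y => G (sqd z y)) (fun=> G S)).
      exact: (continuous_barrier barG az).
    exact: cst_continuous.
move=> a ca Na wa; have az := Nz a Na; split.
  have ad : `|a - z| < d.
    rewrite lt_neqAle ca andbT; apply/eqP => E.
    have h1 := uB a E; have h2 := bar0 a ca az.
    have h3 : c * sqd z a <= c * S by rewrite ler_wpM2l ?(ltW c0)// sqS.
    have h4 : 0 <= e * (G (sqd z a) - G S) by apply: mulr_ge0 => //; exact: ltW.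
    by move: wa; apply/negP; rewrite -leNgt /w; lra.
  near=> b; have cb : cube z d b.
    by apply: ltW; near: b; exact: near_cube.
  have bz : b != z by near: b; exact: near_neq.
  split=> //; rewrite /N /= !lt_min => /andP[/andP[br1 br2] _].
  have h1 : u b <= e / 2 * G (sqd z b).
    apply: Hr1 => //; rewrite -(@ltr_pXn2r _ 2) ?nnegrE ?(ltW r10)//.
    by apply: le_lt_trans br1; exact: sqd_lower.
  have h2 := Hr2 _ (sqd_gt0 bz) br2.
  have h3 : c * sqd z b <= c * S by rewrite ler_wpM2l ?(ltW c0)// sqS.
  have h4 : 0 <= e * (G (sqd z b) - 2 * G S).
    by apply: mulr_ge0; [exact: ltW|rewrite subr_ge0].
  rewrite /w; lra.
have [l s1 E] := sec_barrier barG az.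
have Aa : (A `\ z) a by split; [exact: zA|exact/eqP].
exists (fun i => partial i (partial i u) a + c * 2 - e * (l i - 0) - 0).
  move=> i; apply: secB; last exact: sec_cst.
  apply: secB; first apply: secD.
  - exact: (sec_class_C i (open_setD1 _ oA) Cu).
  - by apply: secZ; exact: sec_sqd.
  - by apply: secZ; apply: secB; [exact: s1|exact: sec_cst].
have S1 : \sum_(i < n) e * (l i - 0) = 0.
  by rewrite -mulr_sumr sumrB E big1// subr0 mulr0.
rewrite !sumrB S1 big_split /= -/(laplacian u a) sumr_const card_ord big1//.
rewrite !subr0 -[_ *+ n]mulr_natl.
have h := uK a ca az.
have h2 : c * 2 <= n%:R * (c * 2) by rewrite ler_peMl// mulr_ge0// ltW.
have h3 : c * 2 = K + 1 by rewrite /c divfK.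
lra.
Unshelve. all: by end_near. Qed.

Lemma punctured_bounded (A : set V) (z : V) (u : V -> R) (d K : R) :
  (0 < n)%N -> open A -> class_C 2 (A `\ z) u -> 0 < d -> cube z d `<=` A ->
  (forall y, cube z d y -> y != z -> `|laplacian u y| <= K) ->
  (forall e : R, 0 < e -> exists2 r : R, 0 < r & forall y, y != z ->
     `|y - z| < r -> `|u y| <= e * G (sqd z y)) ->
  exists M, forall y, cube z d y -> y != z -> `|u y| <= M.
Proof.
move=> n0 oA Cu d0 zA uK uo.
have oAz := open_setD1 z oA.
have sphere_ne y : `|y - z| = d -> y != z.
  by move=> E; rewrite -subr_eq0 -normr_gt0 E.
have Asphere y : `|y - z| = d -> (A `\ z) y.
  move=> E; split; last exact/eqP/sphere_ne.
  by apply: zA; rewrite /cube /= E.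
have [B0 HB0] : exists M : R, forall y, [set y | `|y - z| = d] y -> `|u y| <= M.
  apply: compact_bound.
    rewrite (_ : [set y | _] = cube z d `&` [set y | d <= `|y - z|]).
      apply: compact_closedI; first exact: compact_cube.
      by apply: closed_superlevel; exact: continuous_dist.
    apply/seteqP; split=> y; rewrite /cube /=; first by move=> ->.
    move=> [h1 h2].
    by apply/eqP; rewrite eq_le h1.
  by apply: cont_within => y /Asphere Ay; exact: class_C_cont Cu Ay.
pose B := Num.max 0 B0; pose K1 := Num.max 0 K.
have HB y : `|y - z| = d -> `|u y| <= B by move=> /HB0 h; rewrite le_max h orbT.
have HK y : cube z d y -> y != z -> `|laplacian u y| <= K1.
  by move=> cy yz; rewrite le_max uK// orbT.
exists (B + (K1 + 1) / 2 * (n%:R * d ^+ 2)) => y cy yz; rewrite ler_norml lerNl.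
apply/andP; split; last first.
  apply: (punctured_upper_bound n0 oA Cu d0 zA) => //.
  - by rewrite le_max lexx.
  - by move=> a /HB; apply: le_trans; exact: ler_norm.
  - by rewrite le_max lexx.
  - by move=> a ca az; have := HK a ca az; rewrite ler_norml => /andP[].
  - move=> e /uo[r r0 Hr]; exists r => // a az ar.
    by apply: le_trans (Hr a az ar); exact: ler_norm.
rewrite -mulN1r; pose v a := -1 * u a; rewrite -/(v y).
have Cv : class_C 2 (A `\ z) v := class_CZ (-1) oAz Cu.
apply: (@punctured_upper_bound A z v d B K1 n0 oA Cv d0 zA _ _ _ _ _ y cy yz).
- by rewrite le_max lexx.
- by move=> a /HB; apply: le_trans; rewrite /v mulN1r -normrN; exact: ler_norm.
- by rewrite le_max lexx.
- move=> a ca az; rewrite /v (laplacianZ _ oAz Cu); last by split; [exact: zA|exact/eqP].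
  by have := HK a ca az; rewrite ler_norml mulN1r lerN2 => /andP[].
- move=> e /uo[r r0 Hr]; exists r => // a az ar.
  by apply: le_trans (Hr a az ar); rewrite /v mulN1r -normrN; exact: ler_norm.
Qed.

End laplacian_bounds.

(** * Lipschitz bounds along coordinate paths *)

Section path_bound.
Context {R : realType} {n : nat}.
Local Notation V := 'rV[R]_n.
Local Notation ei i := (delta_mx (ord0 : 'I_1) i : V).

(* The vertices of the path from [x] to [y] that changes one coordinate at a
   time. *)
Definition path_pt (x y : V) (k : nat) : V :=
  \row_j (if (j < k)%N then y ord0 j else x ord0 j).

(** The mean value theorem on each edge, summed. Derivatives are required on the edges only, so the
    lemma can be used around a missing point. *)
Lemma path_bound (f : V -> R) (x y : V) (L : R) :
  (forall (k : 'I_n) (s : R), 0 <= s <= 1 ->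
     let q := (s * (y ord0 k - x ord0 k)) *: ei k + path_pt x y k in
     derivable f q (ei k) /\ `|partial k f q| <= L) ->
  `|f y - f x| <= L * \sum_k `|y ord0 k - x ord0 k|.
Proof.
move=> H.
have p0 : path_pt x y 0 = x by apply/rowP => j; rewrite mxE ltn0.
have pn : path_pt x y n = y by apply/rowP => j; rewrite mxE ltn_ord.
have pS (k : 'I_n) : path_pt x y k.+1 = (y ord0 k - x ord0 k) *: ei k + path_pt x y k.
  apply/rowP => j; rewrite line_entry !mxE ltnS leq_eqVlt.
  have [E|jk] := eqVneq k j.
    by rewrite E eqxx ltnn /= mulr1 addrC subrK.
  rewrite mulr0 addr0; case: (eqVneq (j : nat) k) => [E|//].
  by move: jk; rewrite -(inj_eq val_inj) /= E eqxx.
have -> : f y - f x = \sum_(k < n) (f (path_pt x y k.+1) - f (path_pt x y k)).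
  rewrite -(big_mkord xpredT (fun k => f (path_pt x y k.+1) - f (path_pt x y k))).
  by rewrite telescope_sumr// p0 pn.
apply: le_trans (ler_norm_sum _ _ _) _; rewrite mulr_sumr; apply: ler_sum => k _.
rewrite pS; have [s s01|s s01 ->] := @MVT_dir _ _ f (path_pt x y k) (ei k) (y ord0 k - x ord0 k).
  by have [] := H k s s01.
by rewrite normrM mulrC ler_wpM2r//; have [] := H k s s01.
Qed.

Lemma path_entry (x y : V) (k : 'I_n) (s : R) j :
  ((s * (y ord0 k - x ord0 k)) *: ei k + path_pt x y k) ord0 j =
  if (j < k)%N then y ord0 j else if j == k then
    (1 - s) * x ord0 j + s * y ord0 j else x ord0 j.
Proof.
rewrite line_entry mxE eq_sym; case: (eqVneq j k) => [->|_].
  by rewrite ltnn /=; ring.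
by rewrite mulr0 addr0.
Qed.

Lemma path_cube (c x y : V) (d : R) (k : 'I_n) (s : R) : cube c d x -> cube c d y ->
  0 <= s <= 1 -> cube c d ((s * (y ord0 k - x ord0 k)) *: ei k + path_pt x y k).
Proof.
move=> cx cy /andP[s0 s1].
have d0 : 0 <= d := le_trans (normr_ge0 _) cx.
apply/cubeP => // j; rewrite path_entry.
have hx := cube_entry j cx; have hy := cube_entry j cy.
case: ifP => // _; case: ifP => // _.
rewrite (_ : _ - _ = (1 - s) * (x ord0 j - c ord0 j) + s * (y ord0 j - c ord0 j)); last by ring.
apply: le_trans (ler_normD _ _) _; rewrite !normrM (ger0_norm s0) ger0_norm ?subr_ge0//.
have -> : d = (1 - s) * d + s * d by ring.
by rewrite lerD// ler_wpM2l// subr_ge0.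
Qed.

Lemma cube_lipschitz (f : V -> R) (c x y : V) (d L : R) :
  (forall a, cube c d a -> forall i, derivable f a (ei i) /\ `|partial i f a| <= L) ->
  cube c d x -> cube c d y -> `|f y - f x| <= L * (n%:R * `|y - x|).
Proof.
move=> H cx cy.
apply: le_trans (path_bound (L := L) _) _.
  by move=> k s s01; apply: H; exact: path_cube.
have [n0|n0] := posnP n.
  rewrite big1 ?mulr0.
    by rewrite (_ : n%:R = 0) ?mul0r ?mulr0// n0.
  by move=> k; have := leq_ltn_trans (leq0n k) (ltn_ord k); move/lt0n_neq0/eqP => /(_ n0).
have L0 : 0 <= L by have [_] := H x cx (Ordinal n0); exact: le_trans.
rewrite ler_wpM2l// mulr_natl -[X in _ *+ X]card_ord -sumr_const.
by apply: ler_sum => k _; rewrite -rv_subE entry_le.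
Qed.

End path_bound.

(** * Interior estimates *)

Section interior_estimates.
Context {R : realType} {n : nat}.
Local Notation V := 'rV[R]_n.
Local Notation ei i := (delta_mx (ord0 : 'I_1) i : V).
Variables (G : R -> R).
Hypotheses (barG : barrier n G) (n0 : (0 < n)%N).

Definition gradient_estimate (m : nat) (C : R) : Prop :=
  forall (A : set V) (u : V -> R) (x : V) (r M : R) (i : 'I_n),
    open A -> polyharmonic m A u -> 0 < r -> cube x r `<=` A ->
    (forall y, cube x r y -> `|u y| <= M) -> `|partial i u x| <= C * M / r.

(** The weight degenerating at the faces is what absorption needs: a bound on a smaller cube by the
    supremum over a larger one could not be absorbed. *)
Definition laplacian_estimate (m : nat) (C : R) : Prop :=
  forall (A : set V) (u : V -> R) (x : V) (r M : R),
    open A -> polyharmonic m A u -> 0 < r -> cube x r `<=` A ->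
    (forall y, cube x r y -> `|u y| <= M) ->
    forall y, `|y - x| < r -> `|laplacian u y| <= C * M / (r - `|y - x|) ^+ 2.

Let nR : 0 < n%:R :> R. Proof. by rewrite ltr0n. Qed.

Lemma partial_bound_cube (A : set V) (x : V) (u : V -> R) (d M K : R) i :
  open A -> class_C 2 A u -> 0 < d -> cube x d `<=` A ->
  (forall y, cube x d y -> `|u y| <= M) ->
  (forall y, cube x d y -> `|laplacian u y| <= K) ->
  `|partial i u x| <= n%:R * M / d + K * d / 2.
Proof.
move=> oA Cu d0 xA uM uK.
(* Any point other than x may serve as the removed point. *)
have xz : x != 1 *: ei (Ordinal n0) + x.
  by rewrite -subr_eq0 opprD addrCA subrr addr0 oppr_eq0 -normr_gt0 norm_scale_ei normr1.
apply: (partial_bound barG i oA _ d0 xA xz).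
- by apply: class_C_sub Cu => y [].
- by move=> y cy _; exact: uM.
- by move=> y cy _; exact: uK.
Qed.

(* [S], the maximum of [(r - |y - x|)^2 |Delta u(y)|] over the cube, is bounded
   by a multiple of [M] plus [S / 2]: a function with a large Laplacian on a
   cube is large, and the oscillation of [Delta u] on a small cube around the
   maximum point is controlled by [S] through the gradient estimate for
   [Delta u]. *)
Lemma laplacian_estimateS m C : 0 <= C -> gradient_estimate m C ->
  exists2 C', 0 <= C' & laplacian_estimate m.+1 C'.
Proof.
move=> C0 HC.
(* Small enough for the cube of radius e d to stay well inside (e <= 1/4) and for the oscillation
   term 16 C n e S to be at most S / 2. *)
pose e : R := (4 + 32 * C * n%:R)^-1.
have D0 : 0 < 4 + 32 * C * n%:R by rewrite ltr_pwDl// !mulr_ge0// ltW.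
have e0 : 0 < e by rewrite invr_gt0.
have e4 : e <= 4^-1.
  by rewrite lef_pV2 ?posrE// lerDl !mulr_ge0// ltW.
have eC : 16 * C * n%:R * e <= 2^-1.
  rewrite /e ler_pdivrMr//.
  suff : 0 <= 2^-1 * 4 :> R by lra.
  by rewrite mulr_ge0.
exists (16 * n%:R / e ^+ 2).
  by rewrite divr_ge0 ?exprn_ge0 ?mulr_ge0// ltW.
move=> A u x r M oA Pu r0 xA uM.
have Pf := polyharmonic_laplacian oA Pu.
have Cu : class_C 2 A u by apply: class_C_le Pu.1; rewrite mulnS.
set f := laplacian u in Pf *.
have cf y : cube x r y -> {for y, continuous f}.
  by move=> /xA; exact: class_C_cont Pf.1.
pose g y := (r - `|y - x|) ^+ 2 * `|f y|.
have cg : {within cube x r, continuous g}.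
  apply: cont_within => y cy.
  apply: (@continuousM _ _ (fun y : V => (r - `|y - x|) ^+ 2) (fun y : V => `|f y|)).
    rewrite (_ : (fun _ => _) = (fun y : V => (r - `|y - x|) * (r - `|y - x|))).
      apply: (@continuousM _ _ (fun y : V => r - `|y - x|) (fun y : V => r - `|y - x|));
      (apply: (@continuousB _ _ _ (fun=> r) (fun y : V => `|y - x|));
        [exact: cst_continuous|exact: continuous_dist]).
    by apply/funext => a; rewrite expr2.
  apply: (@continuous_comp _ _ _ f Num.norm); first exact: cf.
  exact: norm_continuous.
have Q0 : cube x r !=set0 by exists x; apply: cube_center; exact: ltW.
have cQ : compact (cube x r) by exact: compact_cube.
have [c] := EVT_max_rV Q0 cQ cg; rewrite inE => cc maxc.
have {}maxc y : cube x r y -> g y <= g c by move=> cy; apply: maxc; rewrite inE.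
suff HS : g c <= 16 * n%:R / e ^+ 2 * M.
  move=> y yx; rewrite ler_pdivlMr ?exprn_gt0 ?subr_gt0// mulrC.
  by apply: le_trans HS; apply: maxc; exact: ltW.
have M0 : 0 <= M.
  by apply: le_trans (uM x _) => //; apply: cube_center; exact: ltW.
pose d := r - `|c - x|.
have d_ge0 : 0 <= d by rewrite subr_ge0.
have [d0|d0] := eqVneq d 0.
  by rewrite /g -/d d0 expr0n mul0r !mulr_ge0 ?invr_ge0 ?exprn_ge0// ltW.
have {d_ge0}d0 : 0 < d by rewrite lt0r d0.
have sub1 : cube c d `<=` cube x r.
  by apply: cube_sub; rewrite /d addrC subrK.
pose s := e * d.
have s0 : 0 < s by rewrite mulr_gt0.
have sd : s <= d / 4 by rewrite /s mulrC ler_wpM2l// ltW.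
have sub2 : cube c (d / 2) `<=` cube c d.
  by move=> y; rewrite /cube /= => h; apply: le_trans h _; lra.
have sub3 : cube c s `<=` cube c (d / 2).
  by move=> y; rewrite /cube /= => h; apply: le_trans h _; lra.
set S := g c in maxc *.
have S0 : 0 <= S by rewrite mulr_ge0// exprn_ge0// ltW.
(* Within d / 2 of c the weight is still at least (d / 2)^2. The gradient estimate on cubes of
   radius d / 4 then gives [L]. *)
have fS y : cube c (d / 2) y -> `|f y| <= 4 * S / d ^+ 2.
  move=> cy; have := maxc y (sub1 _ (sub2 _ cy)); rewrite /g.
  have h : d / 2 <= r - `|y - x|.
    have := ler_distD c y x; have : `|y - c| <= d / 2 by [].
    by rewrite /d; lra.
  move=> h2; rewrite ler_pdivlMr ?exprn_gt0//.
  have h3 : (d / 2) ^+ 2 <= (r - `|y - x|) ^+ 2.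
    by rewrite lerXn2r ?nnegrE//; lra.
  have h4 : (d / 2) ^+ 2 * `|f y| <= S by apply: le_trans h2; rewrite ler_wpM2r.
  rewrite (_ : `|f y| * d ^+ 2 = 4 * ((d / 2) ^+ 2 * `|f y|)); last by field.
  by rewrite ler_wpM2l.
pose L := 16 * C * S / d ^+ 3.
have d40 : 0 < d / 4 by rewrite divr_gt0.
have gradf y : cube c s y -> forall i, derivable f y (ei i) /\ `|partial i f y| <= L.
  move=> cy i.
  have ysub : cube y (d / 4) `<=` cube c (d / 2).
    by apply: cube_sub; have : `|y - c| <= s by []; lra.
  have Ay : cube y (d / 4) `<=` A.
    by move=> a /ysub/sub2/sub1/xA.
  split; last first.
    have -> : L = C * (4 * S / d ^+ 2) / (d / 4).
      by rewrite /L; field; rewrite gt_eqF.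
    by apply: (HC A f y (d / 4)) => // a /ysub; exact: fS.
  have Ayy : A y by apply: Ay; apply: cube_center; exact: ltW.
  (* If m = 0 then [f] is only known to be continuous, but it vanishes on [A]; the two cases are
     separated for this reason. *)
  have Cu3 : (0 < m)%N -> derivable f y (ei i).
    move=> m0; apply: (class_C_derivable (k := (2 * m).-1)) Ayy.
    by move: Pf.1; rewrite -{1}(@prednK (2 * m)) ?muln_gt0.
  have [m0|] := posnP m; last exact: Cu3.
  have fz a : A a -> 0 = f a by move=> Aa; have := Pf.2 a Aa; rewrite m0 => /= ->.
  apply: (@near_eq_derivable _ _ _ (fun=> 0) f); last exact: derivable_cst.
  by have := open_nbhs_nbhs (conj oA Ayy); apply: filterS => a; exact: fz.
have cs : cube c s c by apply: cube_center; exact: ltW.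
have osc y : cube c s y -> `|f y - f c| <= L * (n%:R * s).
  move=> cy; apply: le_trans (cube_lipschitz gradf cs cy) _.
  have L0 : 0 <= L by rewrite divr_ge0 ?exprn_ge0 ?mulr_ge0 ?(ltW d0).
  by rewrite !ler_wpM2l// ltW.
have csA : cube c s `<=` A by move=> a /sub3/sub2/sub1/xA.
have uMs y : cube c s y -> `|u y| <= M by move=> /sub3/sub2/sub1/uM.
(* On the small cube [f] differs from f(c) by at most L n s; the lower bound is applied to u or to
   -u according to the sign of f(c). *)
have key : (`|f c| - L * (n%:R * s)) * s ^+ 2 <= 8 * n%:R * M.
  have [fc|fc] := lerP 0 (f c).
    rewrite (ger0_norm fc).
    apply: (laplacian_ge_bound n0 oA Cu s0 csA uMs) => y cy.
    have := osc y cy; rewrite ler_norml => /andP[h _].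
    by move: h; rewrite lerBrDr addrC; exact.
  rewrite (ltr0_norm fc).
  have Cv : class_C 2 A (fun y => -1 * u y) by exact: class_CZ.
  apply: (laplacian_ge_bound n0 oA Cv s0 csA).
    by move=> y cy; rewrite mulN1r normrN uMs.
  move=> y cy; rewrite (laplacianZ _ oA Cu); last exact: csA.
  have := osc y cy; rewrite ler_norml => /andP[_ h].
  by move: h; rewrite mulN1r -opprD lerN2 lerBlDr addrC; exact.
have fcS : `|f c| = S / d ^+ 2.
  by rewrite /S /g -/d mulrAC mulfV ?mul1r// expf_neq0// gt_eqF.
have {key} key : S * (1 - 16 * C * n%:R * e) * e ^+ 2 <= 8 * n%:R * M.
  apply: le_trans key; rewrite fcS le_eqVlt; apply/orP; left; apply/eqP.
  by rewrite /L /s; field; rewrite gt_eqF.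
rewrite mulrAC ler_pdivlMr ?exprn_gt0//.
have h : S * 2^-1 * e ^+ 2 <= 8 * n%:R * M.
  apply: le_trans key; rewrite ler_wpM2r ?exprn_ge0 ?(ltW e0)// ler_wpM2l//; lra.
lra.
Qed.

(** On the cube of half the size the weight is at least (r / 2)^2, so Delta u is bounded there by C
    M / (r / 2)^2 and the gradient bound applies. *)
Lemma gradient_estimateS m C : 0 <= C -> laplacian_estimate m.+1 C ->
  exists2 C', 0 <= C' & gradient_estimate m.+1 C'.
Proof.
move=> C0 HC; exists (2 * n%:R + C); first by rewrite addr_ge0 ?mulr_ge0// ltW.
move=> A u x r M i oA Pu r0 xA uM.
have M0 : 0 <= M.
  by apply: le_trans (uM x _) => //; apply: cube_center; exact: ltW.
have Cu : class_C 2 A u by apply: class_C_le Pu.1; rewrite mulnS.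
have r20 : 0 < r / 2 by rewrite divr_gt0.
have sub : cube x (r / 2) `<=` cube x r.
  by move=> y; rewrite /cube /= => h; apply: le_trans h _; lra.
have := @partial_bound_cube A x u (r / 2) M (C * M / (r / 2) ^+ 2) i oA Cu r20.
have -> : n%:R * M / (r / 2) + C * M / (r / 2) ^+ 2 * (r / 2) / 2 =
    (2 * n%:R + C) * M / r by field; rewrite gt_eqF.
apply.
- by move=> y /sub/xA.
- by move=> y /sub/uM.
move=> y yr; have yr' : `|y - x| <= r / 2 by [].
have h0 : r / 2 <= r - `|y - x| by lra.
apply: le_trans (HC A u x r M oA Pu r0 xA uM y _) _; first lra.
rewrite ler_wpM2l ?mulr_ge0// lef_pV2 ?posrE ?exprn_gt0//; last lra.
by rewrite lerXn2r ?nnegrE//; lra.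
Qed.

Lemma gradient_estimate_ex m : exists2 C, 0 <= C & gradient_estimate m C.
Proof.
elim: m => [|m [C C0 HC]].
  exists 0 => // A u x r M i oA Pu r0 xA uM; rewrite !mul0r normr_le0.
  have Ax : A x by apply: xA; apply: cube_center; exact: ltW.
  rewrite (@partial_eq _ _ A u (fun=> 0) i x oA)//; last by move=> y Ay; exact: Pu.2.
  by rewrite /partial derive_cst.
have [C' C'0 HC'] := laplacian_estimateS C0 HC.
exact: gradient_estimateS HC'.
Qed.

Lemma laplacian_estimate_ex m : exists2 C, 0 <= C & laplacian_estimate m.+1 C.
Proof. by have [C C0 HC] := gradient_estimate_ex m; exact: laplacian_estimateS HC. Qed.

Lemma iter_laplacian_estimate m j : exists2 C, 0 <= C &
  forall (A : set V) (u : V -> R) (x : V) (r M : R),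
    open A -> polyharmonic (m + j) A u -> 0 < r -> cube x r `<=` A ->
    (forall y, cube x r y -> `|u y| <= M) ->
    `|iter j (@laplacian R n) u x| <= C * M / r ^+ (2 * j).
Proof.
elim: j => [|j [C C0 HC]].
  exists 1 => // A u x r M oA Pu r0 xA uM; rewrite muln0 expr0 divr1 mul1r.
  by apply: uM; apply: cube_center; exact: ltW.
have [C1 C10 HC1] := laplacian_estimate_ex (m + j).
(* The first Laplacian is estimated on the half cube, whence 4 C1; the remaining j start from radius
   r / 2, whence 4^j. *)
exists (C * (4 * C1) * 4 ^+ j); first by rewrite !mulr_ge0// exprn_ge0.
move=> A u x r M oA; rewrite addnS => Pu r0 xA uM; rewrite iterSr.
have M0 : 0 <= M.
  by apply: le_trans (uM x _) => //; apply: cube_center; exact: ltW.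
have r20 : 0 < r / 2 by rewrite divr_gt0.
have -> : C * (4 * C1) * 4 ^+ j * M / r ^+ (2 * j.+1) =
    C * (4 * C1 * M / r ^+ 2) / (r / 2) ^+ (2 * j).
  have E4 : (2 : R) ^+ (2 * j) = 4 ^+ j by rewrite exprM; congr (_ ^+ _); ring.
  have r_neq0 : r != 0 by rewrite gt_eqF.
  rewrite mulnS exprD exprMn exprVn E4; field.
  by rewrite !expf_neq0.
apply: (HC A) => //.
- exact: polyharmonic_laplacian.
- by move=> y yr; apply: xA; rewrite /cube /=; apply: le_trans yr _; lra.
move=> y yr; have yr' : `|y - x| <= r / 2 by [].
have h0 : r / 2 <= r - `|y - x| by lra.
apply: le_trans (HC1 A u x r M oA Pu r0 xA uM y _) _; first lra.
have -> : 4 * C1 * M / r ^+ 2 = C1 * M / (r / 2) ^+ 2 by field; rewrite gt_eqF.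
rewrite ler_wpM2l ?mulr_ge0// lef_pV2 ?posrE ?exprn_gt0//; last lra.
by rewrite lerXn2r ?nnegrE//; lra.
Qed.

End interior_estimates.

(** * Iterated partial derivatives *)

Section iterated_partials.
Context {R : realType} {n : nat}.
Local Notation V := 'rV[R]_n.
Local Notation ei i := (delta_mx (ord0 : 'I_1) i : V).
Implicit Types (f g : V -> R) (A : set V) (s : seq 'I_n).

(** The head of the list is the innermost derivative, as in the recursion of [class_C]; [pder_rcons]
    gives access to the outermost one. *)
Fixpoint pder s f : V -> R := if s is i :: s' then pder s' (partial i f) else f.

Lemma pder_rcons s i f : pder (rcons s i) f = partial i (pder s f).
Proof. by elim: s f => //= j s IH f; rewrite IH. Qed.

Lemma class_C_pder k A f s : (size s <= k)%N -> class_C k A f ->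
  class_C (k - size s) A (pder s f).
Proof.
elim: s k f => [|i s IH] [|k] f //= sk Cf; rewrite ?subn0//.
by rewrite subSS; apply: IH => //; exact: class_C_partial.
Qed.

Lemma class_CS k A f : class_C k A f ->
  (forall s, size s = k -> forall i,
    (forall x, A x -> derivable (pder s f) x (ei i)) /\
    (forall x, A x -> {for x, continuous (partial i (pder s f))})) ->
  class_C k.+1 A f.
Proof.
elim: k f => [|k IH] f Cf H.
  split=> [|i]; first by case: Cf.
  by have [D C] := H [::] erefl i; split.
split=> [|i]; first by case: Cf.
split=> [x|]; first exact: class_C_derivable Cf.
apply: IH; first exact: class_C_partial.
by move=> s sk j; apply: (H (i :: s)); rewrite /= sk.
Qed.

Lemma pder_eq A f g s x : open A -> (forall y, A y -> f y = g y) -> A x ->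
  pder s f x = pder s g x.
Proof.
move=> oA; elim: s f g => [|i s IH] f g fg Ax /=; first exact: fg.
by apply: IH => // y Ay; exact: (partial_eq _ oA fg Ay).
Qed.

Lemma pderB A f g s x : open A -> class_C (size s) A f -> class_C (size s) A g ->
  A x -> pder s (fun y => f y - g y) x = pder s f x - pder s g x.
Proof.
move=> oA; elim: s f g => [|i s IH] f g //= Cf Cg Ax.
rewrite -IH ?class_C_partial//; try exact: class_C_partial.
apply: (pder_eq _ oA) => // y Ay; apply: dv_val; apply: dvB.
  exact: class_C_dv Cf Ay.
exact: class_C_dv Cg Ay.
Qed.

Lemma pderZ A f c s x : open A -> class_C (size s) A f ->
  A x -> pder s (fun y => c * f y) x = c * pder s f x.
Proof.
move=> oA; elim: s f => [|i s IH] f //= Cf Ax.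
rewrite -IH//; last exact: class_C_partial.
apply: (pder_eq _ oA) => // y Ay; apply: dv_val; apply: dvZ.
exact: class_C_dv Cf Ay.
Qed.

Lemma pder_shift f (h : V) s : pder s (fun y => f (y + h)) = fun y => pder s f (y + h).
Proof.
elim: s f => [|i s IH] f //=; rewrite -IH; congr pder.
by apply/funext => y; rewrite partial_shift.
Qed.

(** Two applications of the mean value theorem, first to f(y + t e_j) - f(y) in direction i, then to
    the derivative in direction j. *)
Lemma second_difference_quotient A f i j x : open A -> class_C 2 A f -> A x ->
  forall e : R, 0 < e -> exists2 d : R, 0 < d & forall t : R, 0 < t -> t < d ->
  `|t ^- 2 * (f (t *: ei i + (t *: ei j + x)) - f (t *: ei i + x)
     - (f (t *: ei j + x) - f x)) - partial j (partial i f) x| < e.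
Proof.
move=> oA Cf Ax e e0.
have cp : {for x, continuous (partial j (partial i f))}.
  by apply: (@class_C_cont _ _ 0) Ax; do 2! apply: class_C_partial.
have [d1 d10 Hd1] := (contE _ _).1 cp e e0.
have [d2 d20 Hd2] := open_norm_sub oA Ax.
pose d := Num.min d1 d2 / 2.
have m0 : 0 < Num.min d1 d2 by rewrite lt_min d10.
exists d; first by rewrite divr_gt0.
move=> t t0 td.
have near (a b : R) : 0 <= a <= 1 -> 0 <= b <= 1 ->
    `|(a * t) *: ei i + ((b * t) *: ei j + x) - x| < Num.min d1 d2.
  move=> /andP[a0 a1] /andP[b0 b1]; rewrite addrA addrK.
  apply: le_lt_trans (ler_normD _ _) _; rewrite !norm_scale_ei !ger0_norm ?mulr_ge0 ?(ltW t0)//.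
  have h1 : a * t <= t by rewrite ler_piMl// ltW.
  have h2 : b * t <= t by rewrite ler_piMl// ltW.
  by move: td; rewrite /d; lra.
have nearA (a b : R) : 0 <= a <= 1 -> 0 <= b <= 1 ->
    A ((a * t) *: ei i + ((b * t) *: ei j + x)).
  by move=> a01 b01; apply: Hd2; have := near a b a01 b01; rewrite lt_min => /andP[].
have h1 : 0 <= (1 : R) <= 1 by rewrite ler01 lexx.
have h0 : 0 <= (0 : R) <= 1 by rewrite ler01 lexx.
pose phi y := f (y + t *: ei j) - f y.
have Dphi (s : R) : 0 <= s <= 1 -> dv ((s * t) *: ei i + x) (ei i) phi
    (partial i f ((s * t) *: ei i + x + t *: ei j) - partial i f ((s * t) *: ei i + x)).
  move=> s01; apply: dvB; last first.
    apply: class_C_dv Cf _; have := nearA s 0 s01 h0.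
    by rewrite mul0r scale0r add0r.
  apply: (dv_affine (sg := fun y => y + t *: ei j) (w := ei i)).
    by move=> a; rewrite -!addrA.
  apply: class_C_dv Cf _; have := nearA s 1 s01 h1.
  by rewrite mul1r -addrA [x + _]addrC.
have [s s01|s s01 E1] := @MVT_dir _ _ phi x (ei i) t; first by have [] := Dphi s s01.
have [_] := Dphi s s01; rewrite -/(partial i _) => E2.
have [s' s'01|s' s'01 E3] := @MVT_dir _ _ (partial i f) ((s * t) *: ei i + x) (ei j) t.
  have C1 := class_C_partial i Cf; apply: (class_C_derivable C1).
  by rewrite addrCA; exact: nearA.
have -> : f (t *: ei i + (t *: ei j + x)) - f (t *: ei i + x) - (f (t *: ei j + x) - f x)
    = t ^+ 2 * partial j (partial i f) ((s' * t) *: ei j + ((s * t) *: ei i + x)).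
  transitivity (phi (t *: ei i + x) - phi x).
    by rewrite /phi -[t *: ei i + x + _]addrA [x + t *: ei j]addrC.
  by rewrite E1 E2 [_ + t *: ei j]addrC E3 expr2 mulrA.
rewrite mulrA mulVf ?mul1r ?expf_neq0 ?gt_eqF//; apply: Hd1.
rewrite addrCA; have := near s s' s01 s'01.
by rewrite lt_min => /andP[].
Qed.

(** The second difference is symmetric in i and j, so both mixed derivatives are its limit. *)
Lemma schwarz A f i j x : open A -> class_C 2 A f -> A x ->
  partial i (partial j f) x = partial j (partial i f) x.
Proof.
move=> oA Cf Ax; apply/eqP; rewrite -subr_eq0 -normr_le0.
apply/ler_addgt0Pr => e e0; rewrite add0r.
have e20 : 0 < e / 2 by rewrite divr_gt0.
have [d1 d10 H1] := second_difference_quotient i j oA Cf Ax e20.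
have [d2 d20 H2] := second_difference_quotient j i oA Cf Ax e20.
have m0 : 0 < Num.min d1 d2 by rewrite lt_min d10.
have [t t0] : exists2 t, 0 < t & t < Num.min d1 d2.
  by exists (Num.min d1 d2 / 2); rewrite ?divr_gt0// ltr_pdivrMr// ltr_pMr// ltr1n.
rewrite lt_min => /andP[td1 td2].
have h1 := H1 t t0 td1; have h2 := H2 t t0 td2.
move: h2; rewrite addrCA opprB.
set a := f (t *: ei i + (t *: ei j + x)) in h1 *.
set b := f (t *: ei i + x) in h1 *; set c := f (t *: ei j + x) in h1 *.
rewrite (_ : a - c + _ = a - b - (c - f x)); last by ring.
set q := t ^- 2 * _ in h1 * => h2.
have triv (a' b' c' : R) : a' - b' = (c' - b') - (c' - a') by ring.
rewrite (triv _ _ q).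
apply: le_trans (ler_normB _ _) _; apply: ltW; rewrite [ltRHS](splitr e).
by apply: ltrD; [exact: h1|exact: h2].
Qed.

Lemma laplacian_partial A f i x : open A -> class_C 3 A f -> A x ->
  laplacian (partial i f) x = partial i (laplacian f) x.
Proof.
move=> oA Cf Ax; apply/esym/dv_val.
apply: dv_eq.
  apply: dv_sum => j; apply: class_C_dv Ax; do 2! apply: class_C_partial.
  exact: Cf.
apply: eq_bigr => j _.
rewrite (schwarz i j oA (class_C_partial j Cf) Ax).
apply: (partial_eq _ oA) Ax => y Ay; apply: (schwarz i j oA _ Ay).
exact: class_CW.
Qed.

Lemma iter_laplacian_partial A m f i x : open A -> class_C (2 * m).+1 A f -> A x ->
  iter m (@laplacian R n) (partial i f) x = partial i (iter m (@laplacian R n) f) x.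
Proof.
move=> oA; elim: m f x => // m IH f x Cf Ax; rewrite !iterSr.
rewrite -(IH (laplacian f) x _ Ax); last first.
  by apply: class_C_laplacian => //; move: Cf; rewrite mulnS.
apply: (iter_laplacian_eq _ oA) Ax => y Ay; apply: (laplacian_partial _ oA) Ay.
by apply: class_C_le Cf; rewrite mulnS.
Qed.

Lemma polyharmonic_partial A m f i : open A -> class_C (2 * m).+1 A f ->
  polyharmonic m A f -> polyharmonic m A (partial i f).
Proof.
move=> oA Cf [_ Hf]; split; first exact: class_C_partial.
move=> x Ax; rewrite (iter_laplacian_partial _ oA Cf Ax).
rewrite (@partial_eq _ _ A _ (fun=> 0) i x oA)//.
by rewrite /partial derive_cst.
Qed.

Lemma laplacian_pder A f s x : open A -> smooth A f -> A x ->
  laplacian (pder s f) x = pder s (laplacian f) x.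
Proof.
move=> oA; elim: s f => [|i s IH] f //= Cf Ax.
rewrite IH//; last by move=> k; exact: class_C_partial.
by apply: (pder_eq _ oA) Ax => y Ay; exact: (laplacian_partial _ oA).
Qed.

Lemma smooth_pder A f s : smooth A f -> smooth A (pder s f).
Proof.
move=> Cf k; have := @class_C_pder (k + size s) A f s (leq_addl _ _) (Cf _).
by rewrite addnK.
Qed.

Lemma smooth_iter_laplacian A m f : open A -> smooth A f ->
  smooth A (iter m (@laplacian R n) f).
Proof. by move=> oA Cf k; exact: class_C_iter_laplacian. Qed.

End iterated_partials.

(** * Regularity *)

Section regularity.
Context {R : realType} {n : nat}.
Local Notation V := 'rV[R]_n.
Local Notation ei i := (delta_mx (ord0 : 'I_1) i : V).

Definition dq (i : 'I_n) (t : R) (f : V -> R) (y : V) : R :=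
  t^-1 * (f (y + t *: ei i) - f y).

(** The rate of convergence depends only on [K] and [d]. Where these serve for all points of a cube,
    convergence is uniform and the derivative inherits continuity. *)
Lemma derivable_of_cauchy (f : V -> R) (x : V) (i : 'I_n) (K d : R) : 0 < d -> 0 <= K ->
  (forall t t' : R, t != 0 -> t' != 0 -> `|t| < d -> `|t'| < d ->
     `|dq i t f x - dq i t' f x| <= K * (`|t| + `|t'|)) ->
  derivable f x (ei i) /\
  forall t : R, t != 0 -> `|t| < d -> `|dq i t f x - partial i f x| <= K * `|t|.
Proof.
move=> d0 K0 H.
have D : derivable f x (ei i).
  apply: cauchy_cvg; apply: cauchy_exP => e e0.
  pose r := Num.min d (e / (2 * (K + 1))).
  have K1 : 0 < K + 1 by rewrite ltr_wpDl.
  have r0 : 0 < r by rewrite lt_min d0 divr_gt0 ?mulr_gt0.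
  have [t0 t00 t0r] : exists2 t0, 0 < t0 & t0 < r.
    by exists (r / 2); rewrite ?divr_gt0// ltr_pdivrMr// ltr_pMr// ltr1n.
  exists (dq i t0 f x).
  suff : \forall t \near (0 : R)^', `|dq i t0 f x - dq i t f x| < e.
    apply: filterS => t; rewrite /ball /= (_ : t^-1 *: _ = dq i t f x)//.
    by rewrite /dq /= [x + _]addrC.
  apply/dnbhs_norm_ltP; exists r => // t tn0; rewrite subr0 => tr.
  move: t0r tr; rewrite !lt_min => /andP[t0d t0e] /andP[td te].
  apply: le_lt_trans (H t0 t _ tn0 _ td) _; [by rewrite gt_eqF|by rewrite gtr0_norm|].
  rewrite gtr0_norm//.
  have h : t0 + `|t| < 2 * (e / (2 * (K + 1))) by lra.
  apply: (@le_lt_trans _ _ ((K + 1) * (t0 + `|t|))).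
    by rewrite ler_wpM2r ?addr_ge0 ?(ltW t00)// lerDl.
  rewrite -(ltr_pM2l K1) in h; apply: lt_le_trans h _.
  by rewrite le_eqVlt; apply/orP; left; apply/eqP; field; rewrite gt_eqF.
split=> // t tn0 td; apply/ler_addgt0Pr => e e0.
have /dvP Dv := derivableP D.
pose b := e / (2 * (K + 1)).
have K1 : 0 < K + 1 by rewrite ltr_wpDl.
have b0 : 0 < b by rewrite divr_gt0 ?mulr_gt0.
have e20 : 0 < e / 2 by rewrite divr_gt0.
have [r r0 Hr] := Dv _ e20.
have m0 : 0 < Num.min (Num.min d r) b by rewrite !lt_min d0 r0.
have [t' t'0] : exists2 t', 0 < t' & t' < Num.min (Num.min d r) b.
  by exists (Num.min (Num.min d r) b / 2); rewrite ?divr_gt0// ltr_pdivrMr// ltr_pMr// ltr1n.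
rewrite !lt_min => /andP[/andP[t'd t'r] t'b].
have t'n0 : t' != 0 by rewrite gt_eqF.
have h1 := H t t' tn0 t'n0 td; rewrite gtr0_norm// in h1.
have {}h1 := h1 t'd.
have h2 := Hr t' t'n0; rewrite gtr0_norm// in h2; have {}h2 := h2 t'r.
have E : t'^-1 * (f (t' *: ei i + x) - f x) = dq i t' f x by rewrite /dq [x + _]addrC.
rewrite E -/(partial i f x) in h2.
have h3 : K * t' <= e / 2.
  apply: (@le_trans _ _ ((K + 1) * b)).
    by rewrite ler_pM ?(ltW t'0) ?(ltW t'b)// lerDl.
  by rewrite /b le_eqVlt; apply/orP; left; apply/eqP; field; rewrite gt_eqF.
apply: le_trans (ler_distD (dq i t' f x) _ _) _.
rewrite mulrDr in h1; move: h1 h2 h3; move: (dq _ _ _ _) (dq _ _ _ _) (partial _ _ _) => *; lra.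
Qed.

Lemma shift_cube (c y : V) (r s t : R) i : cube c r y -> `|t| <= s ->
  cube c (r + s) (y + t *: ei i).
Proof.
move=> cy ts; rewrite /cube /= addrAC; apply: le_trans (ler_normD _ _) _.
by rewrite norm_scale_ei lerD.
Qed.

Lemma dq_MVT (f : V -> R) (y : V) (t : R) i : t != 0 ->
  (forall s : R, 0 <= s <= 1 -> derivable f ((s * t) *: ei i + y) (ei i)) ->
  exists2 s : R, 0 <= s <= 1 & dq i t f y = partial i f ((s * t) *: ei i + y).
Proof.
move=> t0 D; have [s s01 E] := MVT_dir D; exists s => //.
by rewrite /dq [y + _]addrC E mulrA mulVf// mul1r.
Qed.

Lemma open_shift (A : set V) (h : V) : open A -> open [set y | A (y + h)].
Proof.
move=> oA; apply: (@open_comp _ _ (fun y : V => y + h) A) => // y _.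
by apply: (@continuousD _ _ _ id (fun=> h)); [exact: cvg_id|exact: cst_continuous].
Qed.

Lemma polyharmonic_dq m (A : set V) f i t : open A -> polyharmonic m A f ->
  polyharmonic m (A `&` [set y | A (y + t *: ei i)]) (dq i t f).
Proof.
move=> oA Pf.
have oB : open (A `&` [set y | A (y + t *: ei i)]).
  by apply: openI => //; exact: open_shift.
apply: (polyharmonicZ _ oB).
have PN : polyharmonic m (A `&` [set y | A (y + t *: ei i)]) (fun y => -1 * f y).
  by apply: (polyharmonicZ _ oB); apply: polyharmonic_sub Pf => y [].
have Ps : polyharmonic m (A `&` [set y | A (y + t *: ei i)]) (fun y => f (y + t *: ei i)).
  by apply: polyharmonic_sub (polyharmonic_shift (t *: ei i) Pf) => y [].
have := polyharmonicD oB Ps PN.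
by congr polyharmonic; apply/funext => y; rewrite mulN1r.
Qed.

Lemma pder_dq (A : set V) f i t s x : open A -> class_C (size s) A f ->
  A x -> A (x + t *: ei i) -> pder s (dq i t f) x = dq i t (pder s f) x.
Proof.
move=> oA Cf Ax Axt.
pose B := A `&` [set y | A (y + t *: ei i)].
have oB : open B by apply: openI => //; exact: open_shift.
have Bx : B x by split.
have C1 : class_C (size s) B f by apply: class_C_sub Cf => y [].
have C2 : class_C (size s) B (fun y => f (y + t *: ei i)).
  by apply: class_C_sub (class_C_shift (t *: ei i) Cf) => y [].
rewrite /dq (pderZ _ oB _ Bx); last exact: class_CB.
by rewrite (pderB oB C2 C1 Bx) pder_shift.
Qed.

Variables (G : R -> R).
Hypotheses (barG : barrier n G) (n0 : (0 < n)%N).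

(** A difference quotient is a derivative at a mean value point; the gradient estimate on the cube
    of radius r / 4 around it applies, as r / 2 + r / 4 + r / 4 = r. *)
Lemma dq_bound m r : 0 < r -> exists2 C, 0 <= C &
  forall (A : set V) f x M i t, open A -> (0 < m)%N -> polyharmonic m A f ->
  cube x r `<=` A -> (forall y, cube x r y -> `|f y| <= M) ->
  t != 0 -> `|t| <= r / 4 ->
  forall y, cube x (r / 2) y -> `|dq i t f y| <= C * M.
Proof.
move=> r0; have [C C0 HC] := gradient_estimate_ex barG n0 m.
exists (C * 4 / r); first by rewrite !mulr_ge0// invr_ge0 ltW.
move=> A f x M i t oA m0 Pf xA fM t0 tr y cy.
have seg (s : R) : 0 <= s <= 1 -> cube x (r / 2 + r / 4) ((s * t) *: ei i + y).
  move=> /andP[s0 s1]; rewrite [_ *: _ + y]addrC; apply: shift_cube => //.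
  by rewrite normrM ger0_norm// (le_trans _ tr)// ler_piMl.
have sub (z : V) : cube x (r / 2 + r / 4) z -> cube z (r / 4) `<=` cube x r.
  by move=> cz; apply: cube_sub; have : `|z - x| <= r / 2 + r / 4 by []; lra.
have r40 : 0 < r / 4 by rewrite divr_gt0.
have [s /seg cs|s s01 ->] := @dq_MVT f y t i t0.
  have Az : A ((s * t) *: ei i + y).
    by apply: xA; apply: (sub _ cs); apply: cube_center; exact: ltW.
  apply: (class_C_derivable (k := (2 * m).-1)) Az.
  by rewrite prednK ?muln_gt0//; exact: Pf.1.
have -> : C * 4 / r * M = C * M / (r / 4) by field; rewrite gt_eqF.
apply: (HC A f _ (r / 4) M i oA Pf r40).
  by move=> a ca; apply: xA; apply: (sub _ (seg s s01)).
by move=> a ca; apply: fM; apply: (sub _ (seg s s01)).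
Qed.

(** The induction hypothesis is applied to the difference quotient of [f], which is polyharmonic
    whatever the order of differentiability left; the outermost derivative results as t tends to
    0. *)
Lemma pder_estimate m s : (0 < m)%N -> (size s <= 2 * m)%N -> forall r, 0 < r ->
  exists2 C, 0 <= C & forall (A : set V) f x M, open A -> polyharmonic m A f ->
  cube x r `<=` A -> (forall y, cube x r y -> `|f y| <= M) -> `|pder s f x| <= C * M.
Proof.
move=> m0; elim/last_ind: s => [|s i IH] sm r r0.
  exists 1 => // A f x M oA Pf xA fM; rewrite mul1r; apply: fM.
  by apply: cube_center; exact: ltW.
rewrite size_rcons in sm.
have r20 : 0 < r / 2 by rewrite divr_gt0.
have [C C0 HC] := IH (ltnW sm) (r / 2) r20.
have [C1 C10 HC1] := dq_bound m r0.
exists (C * C1); first by rewrite mulr_ge0.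
move=> A f x M oA Pf xA fM; rewrite pder_rcons.
have Ax : A x by apply: xA; apply: cube_center; exact: ltW.
have Cs : class_C (2 * m - size s) A (pder s f) by apply: class_C_pder (ltnW sm) Pf.1.
have D : dv x (ei i) (pder s f) (partial i (pder s f) x).
  apply: (class_C_dv (k := (2 * m - size s).-1)) Ax.
  by rewrite prednK// subn_gt0.
apply/ler_addgt0Pr => e e0.
have [d d0 Hd] := (dvP _ _ _ _).1 D e e0.
have m40 : 0 < Num.min d (r / 4) by rewrite lt_min d0 divr_gt0.
have [t t0] : exists2 t, 0 < t & t < Num.min d (r / 4).
  by exists (Num.min d (r / 4) / 2); rewrite ?divr_gt0// ltr_pdivrMr// ltr_pMr// ltr1n.
rewrite lt_min => /andP[td tr].
have tn0 : t != 0 by rewrite gt_eqF.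
have tr' : `|t| <= r / 4 by rewrite gtr0_norm// ltW.
have E : t^-1 * (pder s f (t *: ei i + x) - pder s f x) = dq i t (pder s f) x.
  by rewrite /dq [x + _]addrC.
have := Hd t tn0; rewrite gtr0_norm// => /(_ td); rewrite E => h.
have inA y : cube x (r / 2) y -> A (y + t *: ei i).
  move=> cy; apply: xA; have := shift_cube i cy tr'.
  by rewrite /cube /= => h'; apply: le_trans h' _; lra.
have inA' y : cube x (r / 2) y -> A y.
  by move=> cy; apply: xA; move: cy; rewrite /cube /= => h'; apply: le_trans h' _; lra.
have cx : cube x (r / 2) x by apply: cube_center; exact: ltW.
have Pq := polyharmonic_dq i t oA Pf.
have oB : open (A `&` [set y | A (y + t *: ei i)]).
  by apply: openI => //; exact: open_shift.
have h1 : `|dq i t (pder s f) x| <= C * (C1 * M).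
  rewrite -(pder_dq oA _ Ax (inA x cx)); last by apply: class_C_le Pf.1; exact: ltnW.
  apply: (HC _ _ x _ oB Pq).
    by move=> y cy; split; [exact: inA'|exact: inA].
  exact: (HC1 A f x M i t oA m0 Pf xA fM tn0 tr').
rewrite -mulrA.
have h2 := ler_normB (dq i t (pder s f) x) (dq i t (pder s f) x - partial i (pder s f) x).
rewrite opprB addrCA subrr addr0 in h2.
by apply: le_trans h2 _; apply: lerD => //; exact: ltW.
Qed.

(* The difference quotients of [u] are polyharmonic and converge uniformly, so
   the interior estimates make all their partial derivatives of order at most
   [2 m] converge uniformly. *)
Lemma polyharmonic_classS m (A : set V) u : (0 < m)%N -> open A ->
  polyharmonic m A u -> class_C (2 * m).+1 A u.
Proof.
move=> m0 oA Pu; apply: class_CS Pu.1 _ => s sm i.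
have Cg : class_C 0 A (pder s u).
  by have := class_C_pder (eq_leq sm) Pu.1; rewrite sm subnn.
have C2 : class_C 2 A u by apply: class_C_le Pu.1; rewrite leq_pmulr.
suff H x : A x -> derivable (pder s u) x (ei i) /\ {for x, continuous (partial i (pder s u))}.
  by split=> x /H [].
move=> Ax; have [r1 r10 Hr1] := open_norm_sub oA Ax.
(* Points y of the cube of radius r carry cubes of radius r, contained in radius 2 r; shifts by t
   reach 3 r, and mean value points 4 r < r1. *)
pose r := r1 / 5.
have r0 : 0 < r by rewrite divr_gt0.
have xA : cube x (4 * r) `<=` A.
  move=> y; rewrite /cube /= => h; apply: Hr1; apply: le_lt_trans h _.
  by rewrite /r; lra.
have cub (a b : R) y : a <= b -> cube x a y -> cube x b y.
  by rewrite /cube /= => ab h; exact: le_trans ab.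
pose ii := partial i (partial i u).
have [B HB] : exists B : R, forall y, cube x (4 * r) y -> `|ii y| <= B.
  apply: compact_bound; first exact: compact_cube.
  apply: cont_within => y /xA Ay; apply: (@class_C_cont _ _ 0) Ay.
  by do 2! apply: class_C_partial.
have B0 : 0 <= B.
  by apply: le_trans (HB x _) => //; apply: cube_center; rewrite mulr_ge0// ltW.
have seg (y : V) (t a : R) : cube x (2 * r) y -> `|t| < r -> 0 <= a <= 1 ->
    cube x (3 * r) ((a * t) *: ei i + y).
  move=> cy tr /andP[a0 a1]; have -> : 3 * r = 2 * r + r by ring.
  rewrite [_ *: _ + y]addrC; apply: shift_cube => //.
  by rewrite normrM ger0_norm// (le_trans _ (ltW tr))// ler_piMl.
have seg2 (y : V) (t a : R) : cube x (3 * r) y -> `|t| < r -> 0 <= a <= 1 ->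
    cube x (4 * r) ((a * t) *: ei i + y).
  move=> cy tr /andP[a0 a1]; have -> : 4 * r = 3 * r + r by ring.
  rewrite [_ *: _ + y]addrC; apply: shift_cube => //.
  by rewrite normrM ger0_norm// (le_trans _ (ltW tr))// ler_piMl.
have r34 : 3 * r <= 4 * r by lra.
have dq1 y t : cube x (2 * r) y -> t != 0 -> `|t| < r ->
    `|dq i t u y - partial i u y| <= B * `|t|.
  move=> cy t0 tr.
  have [a a01|a a01 ->] := @dq_MVT u y t i t0.
    by apply: (class_C_derivable C2); apply: xA; apply: cub r34 _; exact: seg.
  have atr : `|a * t| < r.
    move/andP: a01 => [a0 a1]; rewrite normrM ger0_norm//.
    by apply: le_lt_trans tr; rewrite ler_piMl.
  have cy3 : cube x (3 * r) y by apply: cub cy; lra.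
  have [b b01|b b01 ->] := @MVT_dir _ _ (partial i u) y (ei i) (a * t).
    apply: (class_C_derivable (class_C_partial i C2)); apply: xA.
    exact: seg2.
  have h1 := HB _ (seg2 _ _ _ cy3 atr b01).
  rewrite normrM mulrC; apply: ler_pM => //.
  by move/andP: a01 => [a0 a1]; rewrite normrM ger0_norm// ler_piMl.
have [C C0 HC] := pder_estimate m0 (eq_leq sm) r0.
have inA y t : cube x r y -> `|t| < r -> cube y r `<=` A `&` [set a | A (a + t *: ei i)].
  move=> cy tr a ca; have ca2 : cube x (2 * r) a.
    by apply: (cube_sub _ ca); have : `|y - x| <= r by []; lra.
  split; first by apply: xA; apply: cub ca2; lra.
  apply: xA; apply: cub r34 _; have -> : 3 * r = 2 * r + r by ring.
  by apply: shift_cube => //; exact: ltW.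
have cauchy y t t' : cube x r y -> t != 0 -> t' != 0 -> `|t| < r -> `|t'| < r ->
    `|dq i t (pder s u) y - dq i t' (pder s u) y| <= C * B * (`|t| + `|t'|).
  move=> cy t0 t'0 tr t'r.
  have cyy : cube y r y by apply: cube_center; exact: ltW.
  have Cu : class_C (size s) A u by rewrite sm; exact: Pu.1.
  have [Ay Ayt] := inA y t cy tr y cyy; have [_ Ayt'] := inA y t' cy t'r y cyy.
  rewrite -(pder_dq oA Cu Ay Ayt) -(pder_dq oA Cu Ay Ayt').
  pose D := (A `&` [set a | A (a + t *: ei i)]) `&` (A `&` [set a | A (a + t' *: ei i)]).
  have oD : open D by do 2! apply: openI => //; exact: open_shift.
  have P1 : polyharmonic m D (dq i t u).
    by apply: polyharmonic_sub (polyharmonic_dq i t oA Pu) => a [].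
  have P2 : polyharmonic m D (dq i t' u).
    by apply: polyharmonic_sub (polyharmonic_dq i t' oA Pu) => a [].
  have Dy : D y by split; split.
  have Q1 : class_C (size s) D (dq i t u) by rewrite sm; exact: P1.1.
  have Q2 : class_C (size s) D (dq i t' u) by rewrite sm; exact: P2.1.
  rewrite -(pderB oD Q1 Q2 Dy) -mulrA.
  have P3 : polyharmonic m D (fun y => dq i t u y - dq i t' u y).
    have := polyharmonicD oD P1 (polyharmonicZ (-1) oD P2).
    by congr polyharmonic; apply/funext => a; rewrite mulN1r.
  apply: (HC D _ y _ oD P3).
    by move=> a ca; split; [exact: inA cy tr _ ca|exact: inA cy t'r _ ca].
  move=> a ca.
  have ca2 : cube x (2 * r) a.
    by apply: (cube_sub _ ca); have : `|y - x| <= r by []; lra.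
  apply: le_trans (ler_distD (partial i u a) _ _) _; rewrite mulrDr.
  apply: lerD; first exact: dq1.
  by rewrite distrC; exact: dq1.
have CB0 : 0 <= C * B by rewrite mulr_ge0.
have lim y (cy : cube x r y) := derivable_of_cauchy r0 CB0
   (fun t t' t0 t'0 tr t'r => cauchy y t t' cy t0 t'0 tr t'r).
have cx : cube x r x by apply: cube_center; exact: ltW.
split; first by have [] := lim x cx.
apply/contE => e e0.
(* With t fixed, the derivative is within e / 4 of the continuous quotient at both points: a
   three-term estimate. *)
pose t := Num.min (r / 2) (e / (4 * (C * B + 1))).
have K1 : 0 < C * B + 1 by rewrite ltr_wpDl.
have t0 : 0 < t by rewrite lt_min !divr_gt0// mulr_gt0.
have tr : `|t| < r.
  rewrite gtr0_norm//; apply: (@le_lt_trans _ _ (r / 2)); last by lra.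
  by rewrite /t ge_min lexx.
have tn0 : t != 0 by rewrite gt_eqF.
have te : C * B * t <= e / 4.
  apply: (@le_trans _ _ ((C * B + 1) * (e / (4 * (C * B + 1))))).
    by rewrite ler_pM ?(ltW t0)// ?lerDl// /t ge_min lexx orbT.
  by rewrite le_eqVlt; apply/orP; left; apply/eqP; field; rewrite gt_eqF.
have cdq : {for x, continuous (dq i t (pder s u))}.
  apply: (@continuousM _ _ (fun _ : V => t^-1) (fun y : V => pder s u (y + t *: ei i) - pder s u y)).
    exact: cst_continuous.
  have cxx : cube x r x by [].
  have [_ Axt] := inA x t cx tr x cxx.
  apply: (@continuousB _ _ _ (fun y : V => pder s u (y + t *: ei i)) (pder s u)).
    have := class_C_cont (class_C_shift (t *: ei i) Cg) Axt; exact.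
  exact: class_C_cont Cg Ax.
have e40 : 0 < e / 4 by rewrite divr_gt0.
have [d d0 Hd] := (contE _ _).1 cdq _ e40.
exists (Num.min d r); first by rewrite lt_min d0.
move=> y; rewrite lt_min => /andP[yd yr].
have cy : cube x r y by exact: ltW.
have h1 := (lim y cy).2 t tn0 tr; have h2 := (lim x cx).2 t tn0 tr.
have h3 := Hd y yd; rewrite (gtr0_norm t0) in h1 h2.
move: h1 h2 h3; move: (partial i (pder s u) y) (partial i (pder s u) x) (dq i t (pder s u) y)
  (dq i t (pder s u) x) te => a b a' b' te h1 h2 h3.
clear -te h1 h2 h3.
have {}h1 := le_trans h1 te; have {}h2 := le_trans h2 te.
move: h1 h2 h3; rewrite !ler_norml !ltr_norml => /andP[? ?] /andP[? ?] /andP[? ?].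
apply/andP; split; lra.
Qed.

(** Once one extra derivative is gained, the partial derivatives are polyharmonic themselves and the
    gain can be repeated. *)
Lemma polyharmonic_smooth m (A : set V) u : open A -> polyharmonic m A u -> smooth A u.
Proof.
move=> oA Pu.
have [m0|m0] := posnP m.
  move=> k; apply: (@class_C_eq _ _ k A (fun=> 0)) => //; last exact: class_C_cst.
  by move=> y Ay; have := Pu.2 y Ay; rewrite m0 /= => ->.
move=> k; apply: (@class_C_le _ _ _ (2 * m + k)); first exact: leq_addl.
elim: k u Pu => [|k IH] u Pu; first by rewrite addn0; exact: Pu.1.
have C1 := polyharmonic_classS m0 oA Pu.
rewrite addnS; split=> [x|i]; first exact: class_C_cont C1.
split=> [x|]; first exact: class_C_derivable C1.
by apply: IH; exact: polyharmonic_partial.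
Qed.

End regularity.

(** * Extension across a point *)

Section extension.
Context {R : realType} {n : nat}.
Local Notation V := 'rV[R]_n.
Local Notation ei i := (delta_mx (ord0 : 'I_1) i : V).

Definition bounded_near (z : V) (f : V -> R) : Prop :=
  exists M : R, \forall y \near z^', `|f y| <= M.

Lemma bounded_near_fin (I : finType) (z : V) (f : I -> V -> R) :
  (forall i, bounded_near z (f i)) ->
  exists2 M : R, 0 <= M & \forall y \near z^', forall i, `|f i y| <= M.
Proof.
move=> H; have [M HM] := fin_all_exists H.
exists (\sum_i `|M i|); first exact: sumr_ge0.
have : \forall y \near z^', forall i, `|f i y| <= M i by exact: filter_forall.
apply: filterS => y Hy i.
apply: le_trans (Hy i) _; rewrite (bigD1 i)//=; apply: le_trans (ler_norm _) _.
by rewrite lerDl sumr_ge0.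
Qed.

Lemma perturb (z y : V) (i : 'I_n) (d : R) : 0 < d ->
  exists2 y', `|y' - y| < d & y' ord0 i != z ord0 i.
Proof.
move=> d0; have H t : 0 < t -> t < d -> y ord0 i + t != z ord0 i ->
    exists2 y', `|y' - y| < d & y' ord0 i != z ord0 i.
  move=> t0 td yz; exists (t *: ei i + y).
    by rewrite addrK norm_scale_ei gtr0_norm.
  by rewrite line_entry eqxx mulr1.
have [E|] := eqVneq (y ord0 i + d / 2) (z ord0 i); last by apply: H; lra.
apply: (H (d / 3)); [lra|lra|rewrite -E].
by rewrite (inj_eq (addrI _)) lt_eqF//; lra.
Qed.

Variables (i0 i1 : 'I_n).
Hypotheses (i00 : i0 = 0%N :> nat) (i10 : i1 = 1%N :> nat).

(** On the first edge of the path coordinate 1 is still that of the start, on all later edges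
    coordinate 0 is that of the end. If these differ from the coordinates of z, the path misses z;
    the general case follows by perturbing both ends and continuity. *)
Lemma punctured_lipschitz (z x y : V) (u : V -> R) (r L : R) :
  0 <= L ->
  (forall a, a != z -> `|a - z| < r -> {for a, continuous u} /\
     forall i, derivable u a (ei i) /\ `|partial i u a| <= L) ->
  x != z -> `|x - z| < r -> y != z -> `|y - z| < r ->
  `|u y - u x| <= L * n%:R * `|y - x|.
Proof.
move=> L0 H xz xr yz yr.
have gen a b : `|a - z| < r -> `|b - z| < r -> b ord0 i0 != z ord0 i0 ->
    a ord0 i1 != z ord0 i1 -> `|u b - u a| <= L * n%:R * `|b - a|.
  move=> ar br bz az.
  apply: (@le_trans _ _ (L * \sum_k `|b ord0 k - a ord0 k|)).
    apply: path_bound => k s s01 q; have qz : q != z.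
      have [k0|k0] := posnP k.
        apply: contra az => /eqP <-; rewrite /q path_entry i10 k0 /=.
        by rewrite -(inj_eq val_inj) /= i10 k0.
      by apply: contra bz => /eqP <-; rewrite /q path_entry i00 k0.
    have qr : `|q - z| < r.
      have : cube z (Num.max `|a - z| `|b - z|) q.
        by apply: path_cube s01; rewrite /cube /= le_max lexx ?orbT.
      by move/le_lt_trans; apply; rewrite gt_max ar br.
    by have [_] := H q qz qr.
  rewrite -mulrA ler_wpM2l// mulr_natl -[X in _ *+ X]card_ord -sumr_const.
  by apply: ler_sum => k _; rewrite -rv_subE entry_le.
apply: (@le_eps_mul _ _ _ (2 + L * n%:R * 2)) => e e0.
have app w i : w != z -> `|w - z| < r -> exists w', [/\ `|w' - w| < e,
    `|u w' - u w| < e, `|w' - z| < r & w' ord0 i != z ord0 i].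
  move=> wz wr; have [cw _] := H w wz wr.
  have [d d0 Hd] := (contE _ _).1 cw e e0.
  have m0 : 0 < Num.min (Num.min d e) (r - `|w - z|) by rewrite !lt_min d0 e0 subr_gt0.
  have [w' + wi] := perturb z w i m0.
  rewrite !lt_min => /andP[/andP[w1 w2] w3]; exists w'; split => //; first exact: Hd.
  by apply: le_lt_trans (ler_distD w _ _) _; rewrite -ltrBrDr.
have [x' [x1 x2 x3 x4]] := app x i1 xz xr.
have [y' [y1 y2 y3 y4]] := app y i0 yz yr.
have h := gen x' y' x3 y3 y4 x4.
have Ln : 0 <= L * n%:R by rewrite mulr_ge0.
have h2 : `|y' - x'| <= `|y - x| + e * 2.
  apply: le_trans (ler_distD y _ _) _; have := ler_distD x y x'.
  rewrite (distrC x x'); lra.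
have {h h2} h : `|u y' - u x'| <= L * n%:R * (`|y - x| + e * 2).
  by apply: le_trans h _; rewrite ler_wpM2l.
apply: le_trans (ler_distD (u y') _ _) _.
have := ler_distD (u x') (u y') (u x); rewrite (distrC (u y) (u y')).
move: h; rewrite mulrDr; nra.
Qed.

(** A limit along one axis, hence of a function of one variable; [plimP] shows that it is the limit
    from all sides. *)
Definition plim (z : V) (u : V -> R) : R := lim (u (t *: ei i0 + z) @[t --> (0 : R)^']).

Lemma plimP (z : V) (u : V -> R) (r L : R) : 0 <= L -> 0 < r ->
  (forall a, a != z -> `|a - z| < r -> {for a, continuous u} /\
     forall i, derivable u a (ei i) /\ `|partial i u a| <= L) ->
  forall y, y != z -> `|y - z| < r -> `|u y - plim z u| <= L * n%:R * `|y - z|.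
Proof.
move=> L0 r0 H.
have Ln : 0 <= L * n%:R by rewrite mulr_ge0.
pose q (t : R) := u (t *: ei i0 + z).
have qz (t : R) : t != 0 -> t *: ei i0 + z != z.
  by move=> t0; rewrite -subr_eq0 addrK -normr_gt0 norm_scale_ei normr_gt0.
have qr (t : R) : `|t *: ei i0 + z - z| = `|t| by rewrite addrK norm_scale_ei.
have cq : cvg (q t @[t --> (0 : R)^']).
  apply: cauchy_cvg; apply: cauchy_exP => e e0.
  pose d := Num.min r (e / (2 * (L * n%:R + 1))).
  have K1 : 0 < L * n%:R + 1 by rewrite ltr_wpDl.
  have d0 : 0 < d by rewrite lt_min r0 divr_gt0 ?mulr_gt0.
  have [t0 t00] : exists2 t0, 0 < t0 & t0 < d.
    by exists (d / 2); rewrite ?divr_gt0// ltr_pdivrMr// ltr_pMr// ltr1n.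
  rewrite lt_min => /andP[t0r t0e].
  exists (q t0).
  suff : \forall t \near (0 : R)^', `|q t0 - q t| < e by [].
  apply/dnbhs_norm_ltP; exists d => // t tn0; rewrite subr0 lt_min => /andP[tr te].
  apply: le_lt_trans (punctured_lipschitz L0 H (qz _ tn0) _ (qz t0 _) _) _.
  - by rewrite qr.
  - by rewrite gt_eqF.
  - by rewrite qr gtr0_norm.
  rewrite opprD addrACA subrr addr0 -scalerBl norm_scale_ei.
  have h : `|t0 - t| < 2 * (e / (2 * (L * n%:R + 1))).
    apply: le_lt_trans (ler_normB _ _) _; rewrite gtr0_norm//; lra.
  apply: (@le_lt_trans _ _ ((L * n%:R + 1) * `|t0 - t|)).
    by rewrite ler_wpM2r// lerDl.
  rewrite -(ltr_pM2l K1) in h; apply: lt_le_trans h _.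
  by rewrite le_eqVlt; apply/orP; left; apply/eqP; field; rewrite gt_eqF.
move=> y yz yr.
apply: (@le_eps_mul _ _ _ (1 + L * n%:R)) => e e0.
have /cvgrPdist_lt Hl : q t @[t --> (0 : R)^'] --> plim z u by exact: cq.
have /dnbhs_norm_ltP [d d0 Hd] := Hl e e0.
have m0 : 0 < Num.min (Num.min r e) d by rewrite !lt_min r0 e0.
have [t t0] : exists2 t, 0 < t & t < Num.min (Num.min r e) d.
  by exists (Num.min (Num.min r e) d / 2); rewrite ?divr_gt0// ltr_pdivrMr// ltr_pMr// ltr1n.
rewrite !lt_min => /andP[/andP[tr te] td].
have tn0 : t != 0 by rewrite gt_eqF.
have := Hd t tn0; rewrite subr0 (gtr0_norm t0) => /(_ td) h1.
have := punctured_lipschitz L0 H (qz _ tn0); rewrite qr (gtr0_norm t0) => /(_ _ tr yz yr) h2.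
have h3 : `|y - (t *: ei i0 + z)| <= `|y - z| + e.
  rewrite opprD addrCA addrC; apply: le_trans (ler_normD _ _) _; rewrite lerD2l.
  by rewrite normrN norm_scale_ei gtr0_norm// ltW.
have h4 : `|u y - u (t *: ei i0 + z)| <= L * n%:R * (`|y - z| + e).
  by apply: le_trans h2 _; rewrite ler_wpM2l.
apply: le_trans (ler_distD (u (t *: ei i0 + z)) _ _) _.
rewrite mulrDr in h4; rewrite distrC in h1.
have h5 : `|u (t *: ei i0 + z) - plim z u| <= e by rewrite ltW.
by rewrite mulrDr mulr1 addrA addrAC [e * _]mulrC; apply: lerD.
Qed.

Definition ext (z : V) (u : V -> R) (y : V) : R := if y == z then plim z u else u y.

Lemma ext_eq (A : set V) z u y : (A `\ z) y -> u y = ext z u y.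
Proof. by move=> [_ /eqP/negPf yz]; rewrite /ext yz. Qed.

Section at_the_point.
Variables (A : set V) (z : V) (u : V -> R).
Hypotheses (oA : open A) (Az : A z) (Cu : smooth (A `\ z) u)
  (bu : forall s, bounded_near z (pder s u)).

(** [None] stands for [u] and [Some i] for its i-th derivative: the hypotheses of [plimP] are needed
    for both. *)
Lemma bounded_data (i : option 'I_n) : exists r L : R, [/\ 0 < r, 0 <= L &
  forall a, a != z -> `|a - z| < r -> let f := if i is Some i then partial i u else u in
   {for a, continuous f} /\ forall j, derivable f a (ei j) /\ `|partial j f a| <= L].
Proof.
have [r1 r10 Hr1] := open_norm_sub oA Az.
set f := (if i is Some i then partial i u else u).
have Cf : class_C 1 (A `\ z) f.
  by rewrite /f; case: (i) => [j|]; [exact: class_C_partial (Cu 2)|exact: Cu].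
have bf j : bounded_near z (partial j f).
  by rewrite /f; case: (i) => [k|]; [exact: (bu [:: k; j])|exact: (bu [:: j])].
have [L L0 /dnbhs_norm_ltP [r2 r20 Hr2]] := bounded_near_fin bf.
exists (Num.min r1 r2), L; split=> //; first by rewrite lt_min r10.
move=> a az; rewrite lt_min => /andP[ar1 ar2] /=.
have Aa : (A `\ z) a by split; [exact: Hr1|exact/eqP].
split; first exact: class_C_cont Cf Aa.
by move=> j; split; [exact: class_C_derivable Cf Aa|exact: Hr2].
Qed.

Lemma ext_continuous_at : {for z, continuous (ext z u)}.
Proof.
have [r [L [r0 L0 H]]] := bounded_data None.
have P := plimP L0 r0 H.
have Ln : 0 <= L * n%:R by rewrite mulr_ge0.
have K1 : 0 < L * n%:R + 1 by rewrite ltr_wpDl.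
apply/contE => e e0; exists (Num.min r (e / (L * n%:R + 1))).
  by rewrite lt_min r0 divr_gt0.
move=> y; rewrite lt_min => /andP[yr ye]; rewrite /ext eqxx.
case: eqVneq => [_|yz]; first by rewrite subrr normr0.
apply: le_lt_trans (P y yz yr) _.
apply: (@le_lt_trans _ _ ((L * n%:R + 1) * `|y - z|)).
  by rewrite ler_wpM2r// lerDl.
by rewrite mulrC -ltr_pdivlMr.
Qed.

Lemma ext_derive_at i : dv z (ei i) (ext z u) (plim z (partial i u)).
Proof.
have [r [L [r0 L0 H]]] := bounded_data None.
have P := plimP L0 r0 H.
have [r' [L' [r'0 L'0 H']]] := bounded_data (Some i).
have P' := plimP L'0 r'0 H'.
set l := plim z u; set l' := plim z (partial i u) in P' *.
have K0 : 0 <= L' * n%:R by rewrite mulr_ge0.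
have K1 : 0 < L' * n%:R + 1 by rewrite ltr_wpDl.
have ne (t : R) : t != 0 -> t *: ei i + z != z.
  by move=> t0; rewrite -subr_eq0 addrK -normr_gt0 norm_scale_ei normr_gt0.
have key (t : R) : t != 0 -> `|t| < r -> `|t| < r' ->
    `|u (t *: ei i + z) - l - t * l'| <= L' * n%:R * `|t| * `|t|.
  move=> t0 tr tr'.
  pose K := L * n%:R * `|t| + `|t| * `|l'|.
  have K_ge0 : 0 <= K by rewrite addr_ge0 ?mulr_ge0.
  apply: (@le_eps_mul _ _ _ K) => e e0.
  (* The mean value theorem is used between z + th t e_i and z + t e_i, a segment that avoids z; the
     missing piece costs at most th K. *)
  pose th := Num.min e (1 / 2).
  have th0 : 0 < th by rewrite lt_min e0 divr_gt0.
  have the : th <= e by rewrite ge_min lexx.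
  have th1 : th < 1.
    by apply: (@le_lt_trans _ _ (1 / 2)); rewrite ?ge_min ?lexx ?orbT//; lra.
  have tht : (th * t) != 0 by rewrite mulf_neq0// gt_eqF.
  have pt (s : R) : 0 <= s <= 1 ->
      let a := (s * ((1 - th) * t)) *: ei i + ((th * t) *: ei i + z) in
      a != z /\ `|a - z| <= `|t|.
    move=> /andP[s0 s1]; rewrite /= addrA -scalerDl.
    have -> : s * ((1 - th) * t) + th * t = (s * (1 - th) + th) * t by ring.
    have c0 : 0 < s * (1 - th) + th by rewrite ltr_wpDl// mulr_ge0// subr_ge0 ltW.
    have c1 : s * (1 - th) + th <= 1.
      by rewrite -lerBrDr ler_piMl// subr_ge0 ltW.
    split; first by apply: ne; rewrite mulf_neq0// gt_eqF.
    by rewrite addrK norm_scale_ei normrM gtr0_norm// ler_piMl.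
  have [s s01|s s01] := @MVT_dir _ _ u ((th * t) *: ei i + z) (ei i) ((1 - th) * t).
    have [az ar] := pt s s01.
    by have [_ /(_ i)[]] := H _ az (le_lt_trans ar tr).
  have [az ar] := pt s s01.
  have h1 := P' _ az (le_lt_trans ar tr').
  set D := partial i u _ in h1; rewrite -/(partial i u _) -/D.
  have -> : ((1 - th) * t) *: ei i + ((th * t) *: ei i + z) = t *: ei i + z.
    by rewrite addrA -scalerDl; congr (_ *: _ + _); ring.
  move=> E.
  have h2 := P _ (ne _ tht); rewrite addrK norm_scale_ei normrM (gtr0_norm th0) in h2.
  have {}h2 : `|u ((th * t) *: ei i + z) - l| <= L * n%:R * (th * `|t|).
    by apply: h2; apply: le_lt_trans tr; rewrite ler_piMl// ltW.
  have -> : u (t *: ei i + z) - l - t * l' =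
    (1 - th) * t * (D - l') + (u ((th * t) *: ei i + z) - l) - th * (t * l').
    have -> : u (t *: ei i + z) = (1 - th) * t * D + u ((th * t) *: ei i + z).
      by rewrite -E subrK.
    have triv (a b c d w l0 : R) : (1 - a) * b * c + w - l0 - b * d =
      (1 - a) * b * (c - d) + (w - l0) - a * (b * d) by ring.
    exact: triv.
  apply: le_trans (ler_normB _ _) _; apply: le_trans (lerD (ler_normD _ _) (lexx _)) _.
  rewrite !normrM (gtr0_norm th0) (@ger0_norm _ (1 - th)) ?subr_ge0 ?(ltW th1)//.
  have h3 : (1 - th) * `|t| * `|D - l'| <= L' * n%:R * `|t| * `|t|.
    apply: (@le_trans _ _ (`|t| * `|D - l'|)).
      by rewrite ler_wpM2r// ler_piMl// lerBlDr lerDl ltW.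
    rewrite mulrC ler_wpM2r//; apply: le_trans h1 _.
    by rewrite ler_wpM2l.
  rewrite -addrA; apply: lerD => //.
  apply: le_trans (lerD h2 (lexx _)) _.
  apply: (@le_trans _ _ (th * K)); last by rewrite ler_wpM2r.
  by rewrite le_eqVlt; apply/orP; left; apply/eqP; rewrite /K; ring.
apply/dvP => e e0.
exists (Num.min (Num.min r r') (e / (L' * n%:R + 1))).
  by rewrite !lt_min r0 r'0 divr_gt0.
move=> t t0; rewrite !lt_min => /andP[/andP[tr tr'] te].
rewrite /ext eqxx (negPf (ne t t0)) -/l.
have t_gt0 : 0 < `|t| by rewrite normr_gt0.
rewrite -(ltr_pM2l t_gt0) -normrM mulrBr mulrA mulfV// mul1r.
apply: le_lt_trans (key t t0 tr tr') _; rewrite mulrC ltr_pM2l//.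
apply: (@le_lt_trans _ _ ((L' * n%:R + 1) * `|t|)).
  by rewrite ler_wpM2r// lerDl.
by rewrite mulrC -ltr_pdivlMr.
Qed.

End at_the_point.

(** Extension commutes with partial derivatives, by [ext_derive_at] at z itself, so induction on k
    applies to the derivatives. *)
Lemma ext_class_C k (A : set V) (z : V) (u : V -> R) : open A -> A z ->
  smooth (A `\ z) u -> (forall s, bounded_near z (pder s u)) -> class_C k A (ext z u).
Proof.
move=> oA Az; elim: k u => [|k IH] u Cu bu.
  split=> // x Ax; have [->|xz] := eqVneq x z; first exact: ext_continuous_at oA Az Cu bu.
  apply: (@class_C_cont _ _ 0 (A `\ z)); last by split=> //; exact/eqP.
  by apply: class_C_eq (Cu 0%N); [exact: open_setD1|exact: ext_eq].
have C1 : class_C k.+1 (A `\ z) (ext z u).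
  by apply: class_C_eq (Cu k.+1); [exact: open_setD1|exact: ext_eq].
split=> [x Ax|i].
  have [->|xz] := eqVneq x z; first exact: ext_continuous_at oA Az Cu bu.
  by apply: class_C_cont C1 _; split=> //; exact/eqP.
split=> [x Ax|].
  have [->|xz] := eqVneq x z; first by have [] := ext_derive_at oA Az Cu bu i.
  by apply: class_C_derivable C1 _; split=> //; exact/eqP.
apply: (@class_C_eq _ _ k A (ext z (partial i u))) => //.
  move=> y Ay; rewrite /ext; case: eqVneq => [->|yz].
    by apply/esym/dv_val; exact: ext_derive_at oA Az Cu bu i.
  have Ay' : (A `\ z) y by split=> //; exact/eqP.
  by apply: (partial_eq _ (open_setD1 z oA)) Ay' => a; exact: ext_eq.
apply: IH => [j|s]; first exact: class_C_partial.
exact: (bu (i :: s)).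
Qed.

End extension.

(** * Removable singularities *)

Section fundamental_barrier.
Context {R : realType}.

(** At s = |y|^2 these are - ln |y| and |y|^(2-n). *)
Definition fbar (n : nat) (s : R) : R :=
  if n == 2%N then - ln s / 2 else s `^ (1 - n%:R / 2).

Lemma fbar_ge0 n s : 0 < s -> s <= 1 -> 0 <= fbar n s.
Proof.
move=> s0 s1; rewrite /fbar; case: eqP => _; last exact: powR_ge0.
by rewrite divr_ge0// oppr_ge0 ln_le0.
Qed.

Lemma barrier_fbar n : (2 <= n)%N -> barrier n (fbar n).
Proof.
move=> n2; rewrite /fbar; have [->|n_ne2] := eqVneq n 2%N.
  split.
  - exists (fun s => - (2 * s)^-1), (fun s => (2 * s ^+ 2)^-1) => s s0.
    have sn0 : s != 0 by rewrite gt_eqF.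
    split; last by field.
      have D : dv s 1 (@ln R) s^-1 by exact: is_derive1_ln.
      rewrite (_ : (fun _ => _) = (fun s => - 2^-1 * ln s)); last first.
        by apply/funext => a; rewrite !mulNr mulrC.
      apply: dv_eq; first exact: dvZ D.
      by field.
    have D : dv s 1 (fun t : R => t^-1) (- s ^- 2 *: 1).
      by have := @is_deriveV _ (fun t : R => t) s 1 1 sn0 (dv_id s).
    rewrite (_ : (fun _ => _) = (fun s => - 2^-1 * s^-1)); last first.
      by apply/funext => a; rewrite invfM mulNr.
    apply: dv_eq; first exact: dvZ D.
    by rewrite [_ *: 1]mulr1; field.
  - move=> s t s0 st; rewrite ler_pM2r ?invr_gt0// lerN2 ler_ln ?posrE//.
    exact: lt_le_trans st.
  - move=> M; exists (expR (- (2 * M))); first exact: expR_gt0.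
    move=> s s0 sM; rewrite ler_pdivlMr// lerNr.
    have : ln s <= ln (expR (- (2 * M))) by rewrite ler_ln ?posrE ?expR_gt0// ltW.
    rewrite expRK; lra.
have n3 : 3 <= n%:R :> R by rewrite ler_nat; case: n n2 n_ne2 => [|[|[|n]]].
set p : R := 1 - n%:R / 2.
have p0 : p < 0 by rewrite /p; lra.
have pn0 : p != 0 by rewrite lt_eqF.
have decr (s t : R) : 0 < s -> s <= t -> t `^ p <= s `^ p.
  move=> s0 st; have t0 : 0 < t by exact: lt_le_trans st.
  have [q pq] : exists q, p = - q by exists (- p); rewrite opprK.
  rewrite pq !powRN lef_pV2 ?posrE ?powR_gt0//.
  by apply: ge0_ler_powR; rewrite ?nnegrE ?(ltW s0) ?(ltW t0)//; lra.
split.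
- exists (fun s => p * s `^ (p - 1)), (fun s => p * ((p - 1) * s `^ (p - 1 - 1))) => s s0.
  split.
  + by have := is_derive1_powR p s0.
  + apply: dvZ; by have := is_derive1_powR (p - 1) s0.
  + have E : s * s `^ (p - 1 - 1) = s `^ (p - 1).
      rewrite -{1}(powRr1 (ltW s0)) -powRD; last by rewrite (gt_eqF s0) implybT.
      by congr (_ `^ _); ring.
    rewrite (_ : _ + _ = 4 * p * (p - 1) * (s * s `^ (p - 1 - 1)) +
      2 * n%:R * p * s `^ (p - 1)); last by ring.
    rewrite E (_ : n%:R = 2 * (1 - p)); last by rewrite /p; field.
    by ring.
- exact: decr.
move=> M; pose N := Num.max M 1; exists (N `^ p^-1).
  by rewrite powR_gt0// lt_max ltr01 orbT.
have N0 : 0 < N by rewrite lt_max ltr01 orbT.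
move=> s s0 sN; apply: (@le_trans _ _ N); first by rewrite le_max lexx.
have -> : N = (N `^ p^-1) `^ p by rewrite -powRrM mulVf// powRr1 ?ltW.
by apply: decr => //; exact: ltW.
Qed.

(** In dimension 2 scaling adds ln c, which - ln s absorbs once s < 1 / c; otherwise it multiplies
    by a constant. *)
Lemma fbar_scale n (c : R) : 1 <= c -> exists2 C, 0 <= C &
  exists2 d : R, 0 < d & forall s, 0 < s -> s < d -> fbar n (s / c) <= C * fbar n s.
Proof.
move=> c1; have c0 : 0 < c by exact: lt_le_trans c1.
rewrite /fbar; case: eqP => _.
  exists 2 => //; exists c^-1; first by rewrite invr_gt0.
  move=> s s0 sc; rewrite ln_div ?posrE//.
  have : ln s <= ln c^-1 by rewrite ler_ln ?posrE ?invr_gt0// ltW.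
  rewrite lnV ?posrE//; lra.
exists (c^-1 `^ (1 - n%:R / 2)); first exact: powR_ge0.
exists 1 => // s s0 _; rewrite powRM ?invr_ge0 ?(ltW s0) ?(ltW c0)//.
by rewrite mulrC.
Qed.

Lemma enorm_sqd (n : nat) (x z : 'rV[R]_n) : enorm (x - z) = Num.sqrt (sqd z x).
Proof. by congr Num.sqrt; apply: eq_bigr => i _; rewrite rv_subE. Qed.

(** The splitting 2m - n = 2 (m - 1) + (2 - n) of the exponent, in terms of |x - z|^2. *)
Lemma enorm_fbar3 (n m : nat) (x z : 'rV[R]_n) : (3 <= n)%N -> (0 < m)%N -> x != z ->
  enorm (x - z) ^ ((2 * m)%:Z - n%:Z) = sqd z x ^+ m.-1 * fbar n (sqd z x).
Proof.
move=> n3 m0 xz; have s0 := sqd_gt0 xz; rewrite enorm_sqd -powR12_sqrt ?(ltW s0)//.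
rewrite -powR_intmul ?powR_ge0// -powRrM /fbar (gtn_eqF n3).
rewrite -powR_mulrn ?(ltW s0)// -powRD; last by rewrite (gt_eqF s0) implybT.
have E : (m.-1)%:R = m%:R - 1 :> R by rewrite -subn1 natrB.
congr (_ `^ _); rewrite intrB -!pmulrn natrM E; by field.
Qed.

Lemma enorm_fbar2 (m : nat) (x z : 'rV[R]_2) : (0 < m)%N -> x != z ->
  enorm (x - z) ^+ (2 * m - 2) * ln (enorm (x - z))^-1 =
  sqd z x ^+ m.-1 * fbar 2 (sqd z x).
Proof.
move=> m0 xz; have s0 := sqd_gt0 xz; rewrite enorm_sqd.
have -> : (2 * m - 2 = 2 * m.-1)%N by case: m m0 => // m _; rewrite mulnS addKn.
rewrite exprM sqr_sqrtr ?(ltW s0)// /fbar eqxx; congr (_ * _).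
by rewrite lnV ?posrE ?sqrtr_gt0// -powR12_sqrt ?(ltW s0)// ln_powR; field.
Qed.

End fundamental_barrier.

(** * From the growth hypothesis to bounds on all derivatives *)

Section removable_singularities.
Context {R : realType} {n : nat}.
Local Notation V := 'rV[R]_n.
Local Notation ei i := (delta_mx (ord0 : 'I_1) i : V).
Hypothesis n2 : (2 <= n)%N.
Variables (A : set V) (z : V).
Hypotheses (oA : open A) (Az : A z).

Let G := @fbar R n.
Let barG : barrier n G := barrier_fbar n2.
Let n0 : (0 < n)%N := ltnW n2.

Definition small_o (f : V -> R) : Prop := forall e : R, 0 < e ->
  exists2 r : R, 0 < r & forall y, y != z -> `|y - z| < r -> `|f y| <= e * G (sqd z y).

(** On the cube of radius |x - z| / 2 around x all distances to z are comparable with |x - z|. The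
    interior estimate divides by |x - z|^(2j), and j <= m - 1 leaves a nonnegative power. *)
Lemma small_o_iter_laplacian m j (u : V -> R) : (j < m)%N ->
  polyharmonic m (A `\ z) u ->
  (forall e : R, 0 < e -> exists2 r : R, 0 < r & forall y, y != z -> `|y - z| < r ->
     `|u y| <= e * (sqd z y ^+ m.-1 * G (sqd z y))) ->
  small_o (iter j (@laplacian R n) u).
Proof.
move=> jm Pu uo e e0.
have nR : 1 <= n%:R :> R by rewrite ler1n.
have nR0 : 0 < n%:R :> R by rewrite ltr0n.
have [C C0 HC] := iter_laplacian_estimate barG n0 (m - j) j.
rewrite subnK ?(ltnW jm)// in HC.
(* With p = |x - z|, squared distances on the cube are at least p^2 / 4, while that of x is at most
   n p^2: the ratio is 4 n. *)
have c1 : 1 <= 4 * n%:R :> R by lra.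
have [C1 C10 [d d0 Hd]] := fbar_scale n c1.
pose B : R := C * (n%:R * 4) ^+ m.-1 * 4 ^+ j.
have B0 : 0 <= B by rewrite !mulr_ge0 ?exprn_ge0// mulr_ge0// ltW.
have BC : 0 < B * C1 + 1 by rewrite ltr_wpDl// mulr_ge0.
pose e' := e / (B * C1 + 1).
have e'0 : 0 < e' by rewrite divr_gt0.
have [r1 r10 Hr1] := uo e' e'0.
have [r2 r20 Hr2] := open_norm_sub oA Az.
(* Points of the cube are within 2 p of z, hence the halves of r1 and r2; the other bounds give n
   p^2 < min(d, 1). *)
pose r := Num.min (Num.min (r1 / 2) (r2 / 2)) (Num.min (Num.min d 1 / n%:R / 4) (1 / 4)).
have r0 : 0 < r.
  by rewrite !lt_min !divr_gt0//= lt_min d0 ltr01.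
exists r => // x xz; rewrite !lt_min => /andP[/andP[xr1 xr2] /andP[xd x1]].
set p := `|x - z| in xr1 xr2 xd x1 *.
have p0 : 0 < p by rewrite normr_gt0 subr_eq0.
have Hy y : cube x (p / 2) y -> p / 2 <= `|y - z| /\ `|y - z| <= 2 * p.
  move=> cy; have h : `|y - x| <= p / 2 by [].
  have h1 := ler_distD y x z; have h2 := ler_distD x y z.
  rewrite (distrC x y) -/p in h1; rewrite -/p in h2; split; lra.
have yz y : cube x (p / 2) y -> y != z.
  move=> /Hy[h _]; rewrite -subr_eq0 -normr_gt0; lra.
have sq_d : sqd z x < d /\ sqd z x <= 1.
  have h := sqd_upper (lexx p).
  have h3 : n%:R * p ^+ 2 <= n%:R * p.
    by rewrite ler_wpM2l ?(ltW nR0)// expr2 ler_piMl ?(ltW p0)//; lra.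
  have h4 : n%:R * p < Num.min d 1.
    rewrite mulrC -ltr_pdivlMr//; apply: lt_le_trans xd _.
    by rewrite ler_piMr// ?divr_ge0 ?(ltW nR0) ?le_min ?(ltW d0)//; lra.
  have h5 := le_lt_trans (le_trans h h3) h4.
  by move: h5; rewrite lt_min => /andP[h6 h7]; split=> //; exact: ltW.
have [sd s1] := sq_d; have s0 := sqd_gt0 xz.
have p24 : 0 < p ^+ 2 / 4 by rewrite divr_gt0// exprn_gt0.
have p1 : p ^+ 2 / 4 <= 1.
  by have := sqd_lower z x; rewrite -/p; lra.
have GM : G (p ^+ 2 / 4) <= C1 * G (sqd z x).
  apply: le_trans (Hd _ s0 sd); apply: (barrier_decr barG).
    by rewrite divr_gt0// mulr_gt0.
  rewrite ler_pdivrMr ?mulr_gt0// (_ : p ^+ 2 / 4 * (4 * n%:R) = n%:R * p ^+ 2); last by field.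
  exact: sqd_upper.
have Gp0 : 0 <= G (p ^+ 2 / 4) by exact: fbar_ge0.
pose M := e' * ((n%:R * (2 * p) ^+ 2) ^+ m.-1 * G (p ^+ 2 / 4)).
have uM y : cube x (p / 2) y -> `|u y| <= M.
  move=> cy; have [h1 h2] := Hy y cy.
  apply: le_trans (Hr1 y (yz y cy) _) _; first lra.
  have sy0 := sqd_gt0 (yz y cy).
  rewrite ler_wpM2l ?(ltW e'0)//.
  have G1 : G (sqd z y) <= G (p ^+ 2 / 4).
    apply: (barrier_decr barG) => //; apply: le_trans (sqd_lower z y).
    rewrite (_ : p ^+ 2 / 4 = (p / 2) ^+ 2); last by field.
    by rewrite lerXn2r ?nnegrE//; lra.
  have S1 : sqd z y ^+ m.-1 <= (n%:R * (2 * p) ^+ 2) ^+ m.-1.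
    apply: lerXn2r; [exact: sqd_ge0| |exact: sqd_upper].
    by rewrite nnegrE mulr_ge0 ?sqr_ge0// ltW.
  apply: (@le_trans _ _ (sqd z y ^+ m.-1 * G (p ^+ 2 / 4))).
    by rewrite ler_wpM2l// exprn_ge0// sqd_ge0.
  by rewrite ler_wpM2r.
have p20 : 0 < p / 2 by rewrite divr_gt0.
have subA : cube x (p / 2) `<=` A `\ z.
  move=> y cy; split; last exact/eqP/yz.
  by apply: Hr2; have [_ h] := Hy y cy; lra.
apply: le_trans (HC _ u x (p / 2) M (open_setD1 z oA) Pu p20 subA uM) _.
have pn0 : p != 0 by rewrite gt_eqF.
have E4 : (2 : R) ^+ (2 * j) = 4 ^+ j by rewrite exprM; congr (_ ^+ _); ring.
have -> : C * M / (p / 2) ^+ (2 * j) = B * (p ^+ 2) ^+ (m.-1 - j) * (e' * G (p ^+ 2 / 4)).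
  rewrite /M.
  have -> : (n%:R * (2 * p) ^+ 2) ^+ m.-1 = (n%:R * 4) ^+ m.-1 * ((p ^+ 2) ^+ (m.-1 - j) * (p ^+ 2) ^+ j).
    rewrite -exprD subnK; last by rewrite -ltnS (ltn_predK jm).
    by rewrite -exprMn; congr (_ ^+ _); ring.
  rewrite expr_div_n E4 exprM /B; field; rewrite !expf_neq0//.
have q1 : (p ^+ 2) ^+ (m.-1 - j) <= 1.
  by rewrite exprn_ile1// ?exprn_ge0 ?(ltW p0)// exprn_ile1 ?(ltW p0)//; lra.
have eG : 0 <= e' * G (p ^+ 2 / 4) by rewrite mulr_ge0// ltW.
apply: (@le_trans _ _ (B * (e' * G (p ^+ 2 / 4)))).
  by rewrite ler_wpM2r// ler_piMr.
apply: (@le_trans _ _ (B * (e' * (C1 * G (sqd z x))))).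
  by rewrite ler_wpM2l// ler_wpM2l// ltW.
have Gx0 : 0 <= G (sqd z x) by exact: fbar_ge0.
rewrite (_ : B * _ = B * C1 * e' * G (sqd z x)); last by ring.
rewrite ler_wpM2r// /e' mulrA ler_pdivrMr// mulrC ler_wpM2l ?(ltW e0)//.
by rewrite lerDl.
Qed.

(** The Laplacian commutes with [pder], so each derivative of [f] has a bounded Laplacian and the
    gradient bound passes from one order to the next. *)
Lemma bounded_pder (f : V -> R) : smooth (A `\ z) f ->
  (forall s, bounded_near z (pder s (laplacian f))) -> small_o f ->
  forall s, bounded_near z (pder s f).
Proof.
move=> Cf bl fo.
have oAz := open_setD1 z oA.
have data s : exists r K : R, 0 < r /\ cube z r `<=` A /\
    forall y, cube z r y -> y != z -> `|laplacian (pder s f) y| <= K.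
  have [K /dnbhs_norm_ltP[r1 r10 H1]] := bl s.
  have [r2 r20 H2] := open_norm_sub oA Az.
  exists (Num.min r1 r2 / 2), K.
  have m0 : 0 < Num.min r1 r2 by rewrite lt_min r10.
  have sub y : cube z (Num.min r1 r2 / 2) y -> `|y - z| < r1 /\ `|y - z| < r2.
    rewrite /cube /= => h; apply/andP; rewrite -lt_min; apply: le_lt_trans h _; lra.
  split; first by rewrite divr_gt0.
  split; first by move=> y /sub[_]; exact: H2.
  move=> y /sub[yr1 yr2] yz; rewrite (laplacian_pder _ oAz Cf); first exact: H1.
  by split; [exact: H2|exact/eqP].
elim/last_ind => [|s i [M /dnbhs_norm_ltP[r1 r10 H1]]].
  have [r [K [r0 [rA HK]]]] := data [::].
  have [M HM] := punctured_bounded barG n0 oA (Cf 2) r0 rA HK fo.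
  exists M; apply/dnbhs_norm_ltP; exists r => // y yz yr; apply: HM => //; exact: ltW.
rewrite pder_rcons; have [r [K [r0 [rA HK]]]] := data s.
(* If |x - z| < d, the cube of radius d around x contains z and stays within 2 d of it, where both
   bounds hold. Its size does not shrink as x tends to z. *)
pose d := Num.min r (r1 / 2) / 2.
have m0 : 0 < Num.min r (r1 / 2) by rewrite lt_min r0 divr_gt0.
have d0 : 0 < d by rewrite divr_gt0.
have [dr dr1] : 2 * d <= r /\ 2 * d < r1.
  have : 2 * d = Num.min r (r1 / 2) by rewrite /d; field.
  have : Num.min r (r1 / 2) <= r /\ Num.min r (r1 / 2) <= r1 / 2.
    by apply/andP; rewrite -le_min.
  move=> [h1 h2] h3; split; lra.
exists (n%:R * M / d + K * d / 2); apply/dnbhs_norm_ltP; exists d => // x xz xd.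
have sub y : cube x d y -> `|y - z| <= 2 * d.
  by move=> cy; have := ler_distD x y z; have : `|y - x| <= d by []; lra.
have subr y : cube x d y -> cube z r y.
  by move=> /sub h; rewrite /cube /=; exact: le_trans dr.
apply: (partial_bound barG i oA (smooth_pder s Cf 2) d0 _ xz).
- by move=> y /subr/rA.
- by move=> y /sub h yz; apply: H1 => //; exact: le_lt_trans dr1.
- by move=> y /subr cy yz; exact: HK.
Qed.

Lemma bounded_iter_laplacian m (u : V -> R) : polyharmonic m (A `\ z) u ->
  (forall j, (j < m)%N -> small_o (iter j (@laplacian R n) u)) ->
  forall s, bounded_near z (pder s u).
Proof.
move=> Pu uo.
have oAz := open_setD1 z oA.
have Cu := polyharmonic_smooth barG n0 oAz Pu.
suff H k : (k <= m)%N -> forall s, bounded_near z (pder s (iter (m - k) (@laplacian R n) u)).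
  by have := H m (leqnn m); rewrite subnn.
elim: k => [_ s|k IH km].
  rewrite subn0; exists 0.
  have [r r0 Hr] := open_norm_sub oA Az.
  apply/dnbhs_norm_ltP; exists r => // y yz yr.
  have Ay : (A `\ z) y by split; [exact: Hr|exact/eqP].
  rewrite (pder_eq s oAz Pu.2 Ay) (_ : pder s (fun=> 0) = fun=> 0) ?normr0//.
  elim: s {yz yr Ay} => //= i s IHs; rewrite (_ : partial i _ = fun=> 0)//.
  by apply/funext => a; rewrite /partial derive_cst.
apply: bounded_pder.
- exact: smooth_iter_laplacian.
- by have := IH (ltnW km); rewrite -iterS -subSn.
- by apply: uo; rewrite ltn_subrL; case: (m) km.
Qed.

End removable_singularities.

Theorem theorem2 (R : realType) (m n : nat) (Omega : set 'rV[R]_n)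
    (x0 : 'rV[R]_n) (u : 'rV[R]_n -> R)
    (hm : (2 <= m)%N) (hn : (2 <= n)%N)
    (hOmega : domain Omega) (hx0 : Omega x0)
    (hu : polyharmonic m (Omega `\ x0) u)
    (ho3 : (3 <= n)%N ->
       u =o_ (x0^') (fun x => enorm (x - x0) ^ ((2 * m)%:Z - n%:Z)))
    (ho2 : n = 2%N ->
       u =o_ (x0^') (fun x =>
         enorm (x - x0) ^+ (2 * m - 2) * ln ((enorm (x - x0))^-1))) :
  removable_singularity m Omega x0 u.
Proof.
have [_ oO _] := hOmega.
have m0 : (0 < m)%N by exact: ltnW.
have oOz := open_setD1 x0 oO.
have n0 : (0 < n)%N by exact: ltnW.
have uo : forall e : R, 0 < e -> exists2 r : R, 0 < r & forall y, y != x0 ->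
    `|y - x0| < r -> `|u y| <= e * (sqd x0 y ^+ m.-1 * fbar n (sqd x0 y)).
  move=> e e0.
  (* Near the pole the barrier is nonnegative, so the absolute value that the o-notation puts on the
     rate can be removed. *)
  have [d1 d10 Hd1] := barrier_pole (@barrier_fbar R n hn) 0.
  have absE y : y != x0 -> sqd x0 y < d1 ->
      `|sqd x0 y ^+ m.-1 * fbar n (sqd x0 y)| = sqd x0 y ^+ m.-1 * fbar n (sqd x0 y).
    move=> yx yd; rewrite ger0_norm// mulr_ge0 ?exprn_ge0 ?sqd_ge0//.
    by apply: Hd1 => //; exact: sqd_gt0.
  have near_d : \forall y \near x0^', sqd x0 y < d1.
    have o : open [set y | sqd x0 y < d1] by apply: open_sublevel; exact: continuous_sqd.
    have sx : sqd x0 x0 < d1 by rewrite /sqd big1// => i _; rewrite subrr expr0n.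
    exact: nbhs_dnbhs (open_nbhs_nbhs (conj o sx)).
  apply/dnbhs_norm_ltP.
  have ne : \forall y \near x0^', y != x0 by apply/dnbhs_norm_ltP; exists 1.
  have [n3|] := ltnP 2 n.
    have /eqoP/(_ e e0) H := ho3 n3.
    apply: filterS3 H near_d ne => y; rewrite /= => + yd yx.
    by rewrite (enorm_fbar3 n3 m0 yx) absE.
  move=> nle; have En : n = 2%N by apply/eqP; rewrite eqn_leq nle.
  have /eqoP/(_ e e0) H := ho2 En.
  apply: filterS3 H near_d ne => y; rewrite /= => + yd yx.
  suff -> : enorm (y - x0) ^+ (2 * m - 2) * ln (enorm (y - x0))^-1 =
    sqd x0 y ^+ m.-1 * fbar n (sqd x0 y) by rewrite absE.
  (* Everything whose type depends on n is generalised or cleared, so that n can be replaced by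
     2. *)
  move: yx; clear -En m0; move: x0 y; rewrite En => x0 y yx.
  exact: enorm_fbar2.
have bu := bounded_iter_laplacian hn oO hx0 hu
  (fun j jm => small_o_iter_laplacian hn oO hx0 jm hu uo).
have Cu := polyharmonic_smooth (barrier_fbar hn) n0 oOz hu.
pose i0 : 'I_n := Ordinal n0; pose i1 : 'I_n := Ordinal hn.
pose v := ext i0 x0 u.
have Cv k : class_C k Omega v.
  exact: (@ext_class_C R n i0 i1 erefl erefl k Omega x0 u oO hx0 Cu bu).
have uv y : (Omega `\ x0) y -> u y = v y by exact: ext_eq.
have Pv : polyharmonic m Omega v.
  split=> // x Ox.
  have off y : Omega y -> y != x0 -> iter m (@laplacian R n) v y = 0.
    move=> Oy /eqP yx; rewrite -(iter_laplacian_eq m oOz uv (conj Oy yx)).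
    exact: hu.2.
  (* At x0 itself: the iterated Laplacian of [v] is continuous and vanishes at points x0 + t e_0
     arbitrarily close by. *)
  have [->|] := eqVneq x x0; last exact: off.
  apply/eqP; rewrite -normr_le0 leNgt; apply/negP => v0.
  have c : {for x0, continuous (iter m (@laplacian R n) v)}.
    by apply: (@class_C_cont _ _ 0) hx0; apply: class_C_iter_laplacian.
  have [d d0 Hd] := (contE _ _).1 c _ v0.
  have [r r0 Hr] := open_norm_sub oO hx0.
  have mi0 : 0 < Num.min d r by rewrite lt_min d0.
  have [t t0] : exists2 t, 0 < t & t < Num.min d r.
    by exists (Num.min d r / 2); rewrite ?divr_gt0// ltr_pdivrMr// ltr_pMr// ltr1n.
  rewrite lt_min => /andP[td tr].
  pose y : 'rV[R]_n := t *: delta_mx ord0 i0 + x0.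
  have yn : `|y - x0| = t by rewrite /y addrK norm_scale_ei gtr0_norm.
  have := Hd y; rewrite yn => /(_ td); rewrite off.
  - by rewrite sub0r normrN ltxx.
  - by apply: Hr; rewrite yn.
  - by rewrite -subr_eq0 -normr_gt0 yn.
have [r r0 Hr] := open_norm_sub oO hx0.
have ball_le x d : enorm (x - x0) < d -> `|x - x0| < d.
  move=> h; apply: le_lt_trans h; rewrite enorm_sqd.
  by rewrite -[leLHS](@ger0_norm _ `|x - x0|)// -sqrtr_sqr ler_sqrt ?sqd_ge0// sqd_lower.
have sub : eball x0 (r / 2) `<=` Omega.
  by move=> x /ball_le h; apply: Hr; apply: lt_trans h _; lra.
exists (r / 2), v; split.
- by rewrite divr_gt0.
- apply: (@subset_trans _ (cube x0 (r / 2))).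
    rewrite [X in _ `<=` X](closure_id _).1; last exact: closed_cube.
    by apply: closureS => x /ball_le h; exact: ltW.
  by move=> x; rewrite /cube /= => h; apply: Hr; apply: le_lt_trans h _; lra.
- by move=> k; exact: class_C_sub (Cv k).
- exact: polyharmonic_sub Pv.
- move=> x /andP[x1 x2]; apply: uv; split; first by apply: sub.
  move=> xx0; move: x1; rewrite xx0 subrr /enorm big1 ?sqrtr0 ?ltxx//.
  by move=> i _; rewrite mxE expr0n.
Qed.
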